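(* Fix $p\in(0,1]$. There exists a constant $C=C(p)>0$, depending only on $p$, such that the following holds for all positive integers $d_1,d_2,k,n$ with $k\le\min\{d_1,d_2\}$, all reals $\beta,\sigma>0$ and every random vector $X=[X_1;X_2]$ in $\mathbb{R}^{d_1}\times\mathbb{R}^{d_2}$. Suppose $\|X-\mathbb{E}X\|_{2,\infty}\leq\beta$ almost surely and $\min_{i\in\{1,2\}}\lambda_{\min}(\Sigma_{X_i})\geq\sigma^2>0$. Let $\hat X$ be the random vector distributed uniformly over $n$ independent realizations of $X$. Then for every $\epsilon\in(0,1]$, it holds that \[ \Big|\min_{A\in S_{\hat{X}}}f_{\hat{X}}(A)-\min_{A\in S_X}f_X(A)\Big|\leq \epsilon\cdot\frac{\beta^2}{\sigma^2} \] in an event of probability $\geq 1-p$ (over the draw of the $n$ realizations), provided \[ n\geq C\Big((d_1+d_2)\cdot\tfrac{k}{\epsilon^2}\log(\tfrac{k}{\epsilon^2})+(\tfrac{\beta}{\epsilon\sigma})^4\cdot\log(d_1+d_2)\Big). \]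
   Context: Notation. For $x=[x_1;x_2]\in\mathbb{R}^{d_1}\times\mathbb{R}^{d_2}$, $\|x\|_{2,\infty}:=\max\{\|x_1\|_2,\|x_2\|_2\}$. $\lambda_{\min}$ denotes the smallest eigenvalue of a symmetric matrix. For a random vector $X=[X_1;X_2]\in\mathbb{R}^{d_1}\times\mathbb{R}^{d_2}$ and $i\in\{1,2\}$, the covariance is $\Sigma_{X_i}:=\mathbb{E}(X_i-\mathbb{E}X_i)(X_i-\mathbb{E}X_i)^\top$. Put $V:=\mathbb{R}^{k\times d_1}\times\mathbb{R}^{k\times d_2}$, and for $A=(A_1,A_2)\in V$ define \[ f_X(A)=f_X(A_1,A_2):=\mathbb{E}\|A_1(X_1-\mathbb{E}X_1)-A_2(X_2-\mathbb{E}X_2)\|_2^2, \] \[ S_X:=\{(A_1,A_2)\in V: A_i\Sigma_{X_i}A_i^\top=I_k,\ i\in\{1,2\}\}. \] Given $n$ independent copies $\{[X_{1j};X_{2j}]\}_{j\in[n]}$ of $X$, the vector $\hat X=[\hat X_1;\hat X_2]$ is, conditionally on these realizations, uniformly distributed over the $n$ realizations. Thus (with $\hat X$'s expectation conditional on the sample) $\hat X_i$ has mean $\hat\mu_i=\frac1n\sum_{j\in[n]}X_{ij}$ and covariance $\Sigma_{\hat X_i}=\frac1n\sum_{j\in[n]}(X_{ij}-\hat\mu_i)(X_{ij}-\hat\mu_i)^\top$, and $f_{\hat X}(A)=\frac1n\sum_{j\in[n]}\|A_1(X_{1j}-\hat\mu_1)-A_2(X_{2j}-\hat\mu_2)\|_2^2$;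 so $f_{\hat X}$ and $S_{\hat X}$ are functions of the random sample. The asserted inequality includes that both minima are over nonempty sets. *)

(* Defs.v *)
From HB Require Import structures.
From mathcomp Require Import all_boot all_order all_algebra.
From mathcomp Require Import all_classical all_reals all_analysis.

Set Implicit Arguments.
Unset Strict Implicit.
Unset Printing Implicit Defensive.

Import Order.TTheory GRing.Theory Num.Theory.
Import numFieldNormedType.Exports.

Local Open Scope classical_set_scope.
Local Open Scope ring_scope.

(* The norm [`|x|] provided by the library on matrices is the sup norm, hence
   an explicit Euclidean norm. *)
Definition norm2 (R : realType) (d : nat) (x : 'cV[R]_d) : R :=
  Num.sqrt (\sum_(i < d) x i 0 ^+ 2).

Definition norm2inf (R : realType) (d1 d2 : nat)
    (x : 'cV[R]_d1 * 'cV[R]_d2) : R :=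
  Num.max (norm2 x.1) (norm2 x.2).

(* [inf] is a minimum here: the spectrum is finite, and it is nonempty when [M]
   is symmetric of positive size. *)
Definition lambda_min (R : realType) (d : nat) (M : 'M[R]_d) : R :=
  inf [set a | eigenvalue M a].

Definition is_min (R : realType) (T : Type) (S : set T) (f : T -> R) (m : R) :
    Prop :=
  (exists2 a, S a & f a = m) /\ (forall a, S a -> m <= f a).

(* R^d1 x R^d2 with its Borel sigma-algebra; a random vector on a probability
   space [(T, P)] is an [X : {RV P >-> rvec R d1 d2}]. *)
Definition rvec (R : realType) (d1 d2 : nat) :=
  g_sigma_algebraType (@open ('cV[R]_d1 * 'cV[R]_d2)%type).

Definition same_law (R : realType) (d1 d2 : nat)
    (dT dT' : measure_display) (T : measurableType dT) (T' : measurableType dT')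
    (P : probability T R) (P' : probability T' R)
    (X : {RV P >-> rvec R d1 d2}) (Y : {RV P' >-> rvec R d1 d2}) : Prop :=
  forall B : set (rvec R d1 d2), measurable B ->
    distribution P X B = distribution P' Y B.

(* Taking some of the [B j] to be the whole space gives the product rule for
   every subfamily. *)
Definition mutually_independent (R : realType) (d1 d2 n : nat)
    (dT : measure_display) (T : measurableType dT) (P : probability T R)
    (Y : 'I_n -> {RV P >-> rvec R d1 d2}) : Prop :=
  forall B : 'I_n -> set (rvec R d1 d2), (forall j, measurable (B j)) ->
    P (\bigcap_(j in [set: 'I_n]) (Y j @^-1` B j)) =
    (\prod_(j < n) P (Y j @^-1` B j))%E.

Definition independent_copies (R : realType) (d1 d2 n : nat)
    (dT dT' : measure_display) (T : measurableType dT) (T' : measurableType dT')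
    (P : probability T R) (P' : probability T' R)
    (X : {RV P >-> rvec R d1 d2}) (Y : 'I_n -> {RV P' >-> rvec R d1 d2}) :
    Prop :=
  mutually_independent Y /\ (forall j, same_law X (Y j)).

(* The quantities below are parameterized by an expectation operator
   [E : (T -> R) -> R], so that the same definitions apply to a random vector on
   a probability space ([E := expect P]) and to a vector drawn uniformly from
   the n entries of a list of realizations indexed by ['I_n] ([E := @expect_unif
   R n]). *)
Definition expect (R : realType) (dT : measure_display) (T : measurableType dT)
    (P : probability T R) (g : T -> R) : R :=
  fine 'E_P[g].

Definition expect_unif (R : realType) (n : nat) (g : 'I_n -> R) : R :=
  n%:R^-1 * \sum_(j < n) g j.

Definition expect_mx (R : realType) (T : Type) (E : (T -> R) -> R) (m n : nat)
    (M : T -> 'M[R]_(m, n)) : 'M[R]_(m, n) :=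
  \matrix_(i < m, j < n) E (fun t => M t i j).

Definition covmx (R : realType) (T : Type) (E : (T -> R) -> R) (d : nat)
    (Y : T -> 'cV[R]_d) : 'M[R]_d :=
  expect_mx E (fun t => (Y t - expect_mx E Y) *m (Y t - expect_mx E Y)^T).

Section Objective.
Context (R : realType) (T : Type) (E : (T -> R) -> R) (k d1 d2 : nat).
Variable X : T -> 'cV[R]_d1 * 'cV[R]_d2.

Definition comp1 (t : T) : 'cV[R]_d1 := (X t).1.

Definition comp2 (t : T) : 'cV[R]_d2 := (X t).2.

Definition mean_pair : 'cV[R]_d1 * 'cV[R]_d2 :=
  (expect_mx E comp1, expect_mx E comp2).

Definition objective (A : 'M[R]_(k, d1) * 'M[R]_(k, d2)) : R :=
  E (fun t => norm2 (A.1 *m (comp1 t - expect_mx E comp1)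
                     - A.2 *m (comp2 t - expect_mx E comp2)) ^+ 2).

Definition feasible : set ('M[R]_(k, d1) * 'M[R]_(k, d2)) :=
  [set A | A.1 *m covmx E comp1 *m A.1^T = 1%:M /\
           A.2 *m covmx E comp2 *m A.2^T = 1%:M].

End Objective.

(* Main.v *)
Require Import Defs.
From HB Require Import structures.
From mathcomp Require Import all_boot all_order all_algebra.
From mathcomp Require Import all_classical all_reals all_analysis.
From mathcomp Require Import measurable_realfun ring lra.

(** Only second moments are used.  On the feasible set, the objective and the
constraints depend on [X] through the joint covariance [S] of the stacked vector
[[X1; X2]] alone: with [B = [A1, - A2]] the objective is [tr (B S B^T)], and the
constraints involve the two diagonal blocks of [S].  The proof has three parts.

Concentration.  Let [z] be the vector made of [beta] and of the centered
coordinates of [X], so that [|z|^2 <= 3 beta^2] almost surely.  The empirical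
means of the products [z_a z_b] have a total mean square deviation at most
[E |z|^4 / n <= 9 beta^4 / n] ([expect_sqr_dev_le]), so Markov's inequality bounds
it by [9 beta^4 / (n p)] outside an event of probability [p].  As the entries
[beta z_a] control the deviation of the mean, this bounds the Frobenius distance
between the empirical covariance and [S] ([covmx_concentration]).  The hypothesis
on [n] turns the bound into [sigma^2 eps / 30].  No dimension enters, because
[beta] bounds the whole vector and not its coordinates.

Perturbation.  Let [A] be feasible for [S].  The lower bound [sigma^2] on the
spectrum gives [A] operator norm at most [1 / sigma], so that for a covariance
[S'] at distance at most [t sigma^2] from [S] the Gram matrix [A S' A^T] differs
from the identity by at most [t] in Frobenius norm ([orthorows_congr_le]).  Then
there is an exactly feasible point within distance [t] of [A] in the seminorm of
[S'] ([orthorows_near]).  Since the objective of [S'] is the square of a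
seminorm, it moves by a multiple of [k t] ([pair_perturb]).  Exchanging [S] and
[S'] compares the two minima ([pair_min_close]), and their distance is at most
[k eps].

Conclusion.  The trace of [S] is at least [(d1 + d2) sigma^2] and at most
[2 beta^2], hence [k <= beta^2 / sigma^2]. *)

Set Implicit Arguments.
Unset Strict Implicit.
Unset Printing Implicit Defensive.

Import Order.TTheory GRing.Theory Num.Theory.
Import numFieldNormedType.Exports.

Local Open Scope classical_set_scope.
Local Open Scope ring_scope.

(** * Quadratic forms and the Frobenius norm *)

Section MatrixForms.
Context {R : realType}.

(** The Loewner inequality [s * 1 <= S] for a symmetric [S], tested on matrices of any
height, that is, on finite families of vectors at once; [form_ge S 0] says that
[S] is positive semidefinite. *)
Definition form_ge d (S : 'M[R]_d) (s : R) : Prop :=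
  S^T = S /\
  forall m (A : 'M[R]_(m, d)), s * \tr (A *m A^T) <= \tr (A *m S *m A^T).

Definition qnorm d (S : 'M[R]_d) m (A : 'M[R]_(m, d)) : R :=
  Num.sqrt (\tr (A *m S *m A^T)).

Definition fnorm m d (A : 'M[R]_(m, d)) : R := Num.sqrt (\tr (A *m A^T)).

Lemma tr_mulmx_trE m d (A B : 'M[R]_(m, d)) :
  \tr (A *m B^T) = \sum_i \sum_j A i j * B i j.
Proof.
by apply: eq_bigr => i _; rewrite mxE; apply: eq_bigr => j _; rewrite mxE.
Qed.

Lemma tr_mulmx_ge0 m d (A : 'M[R]_(m, d)) : 0 <= \tr (A *m A^T).
Proof.
by rewrite tr_mulmx_trE; do 2![apply: sumr_ge0 => ? _]; rewrite -expr2 sqr_ge0.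
Qed.

Lemma fnorm_ge0 m d (A : 'M[R]_(m, d)) : 0 <= fnorm A.
Proof. exact: sqrtr_ge0. Qed.

Lemma qnorm_ge0 d (S : 'M[R]_d) m (A : 'M[R]_(m, d)) : 0 <= qnorm S A.
Proof. exact: sqrtr_ge0. Qed.

Lemma fnorm_sqr m d (A : 'M[R]_(m, d)) : fnorm A ^+ 2 = \tr (A *m A^T).
Proof. by rewrite sqr_sqrtr// tr_mulmx_ge0. Qed.

Lemma fnorm_sqrE m d (A : 'M[R]_(m, d)) :
  fnorm A ^+ 2 = \sum_i \sum_j A i j ^+ 2.
Proof. by rewrite fnorm_sqr tr_mulmx_trE. Qed.

Lemma fnorm_eq0 m d (A : 'M[R]_(m, d)) : (fnorm A == 0) = (A == 0).
Proof.
apply/eqP/eqP => [fA0|->]; last by rewrite /fnorm mul0mx mxtrace0 sqrtr0.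
have /eqP := fnorm_sqrE A.
rewrite fA0 expr0n/= eq_sym psumr_eq0; last first.
  by move=> i _; apply: sumr_ge0 => j _; exact: sqr_ge0.
move=> /allP A0; apply/matrixP => i j; rewrite mxE.
have /implyP/(_ isT) := A0 i (mem_index_enum i).
rewrite psumr_eq0; last by move=> l _; exact: sqr_ge0.
by move=> /allP/(_ j (mem_index_enum j)); rewrite /= sqrf_eq0 => /eqP.
Qed.

Lemma fnorm_tr m d (A : 'M[R]_(m, d)) : fnorm A^T = fnorm A.
Proof. by rewrite /fnorm trmxK mxtrace_mulC. Qed.

Lemma form_geW d (S : 'M[R]_d) s s' : s' <= s -> form_ge S s -> form_ge S s'.
Proof.
move=> ss' [symS Ss]; split=> // m A; apply: le_trans (Ss m A).
by rewrite ler_wpM2r// tr_mulmx_ge0.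
Qed.

Lemma form_ge1 d : form_ge (1%:M : 'M[R]_d) 0.
Proof. by split=> [|m A]; rewrite ?trmx1// mul0r mulmx1 tr_mulmx_ge0. Qed.

Section Seminorm.
Variables (d : nat) (S : 'M[R]_d).
Hypothesis S0 : form_ge S 0.

Lemma form_ge0 m (A : 'M[R]_(m, d)) : 0 <= \tr (A *m S *m A^T).
Proof. by have := S0.2 m A; rewrite mul0r. Qed.

Lemma qnorm_sqr m (A : 'M[R]_(m, d)) : qnorm S A ^+ 2 = \tr (A *m S *m A^T).
Proof. by rewrite sqr_sqrtr// form_ge0. Qed.

Lemma form_sym m (A B : 'M[R]_(m, d)) : \tr (A *m S *m B^T) = \tr (B *m S *m A^T).
Proof. by rewrite -mxtrace_tr !trmx_mul trmxK S0.1 mulmxA. Qed.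

Lemma formDZ m (A B : 'M[R]_(m, d)) t :
  \tr ((A + t *: B) *m S *m (A + t *: B)^T) =
  \tr (A *m S *m A^T) + 2 * t * \tr (A *m S *m B^T)
    + t ^+ 2 * \tr (B *m S *m B^T).
Proof.
rewrite linearD/= linearZ/= !(mulmxDl, mulmxDr) -!(scalemxAl, scalemxAr).
rewrite !(mxtraceD, mxtraceZ) (form_sym B A); ring.
Qed.

(** The discriminant argument: [t |-> \tr ((A + t B) S (A + t B)^T)] is a nonnegative
polynomial of degree at most two. *)
Lemma form_cauchy_schwarz m (A B : 'M[R]_(m, d)) :
  `|\tr (A *m S *m B^T)| <= qnorm S A * qnorm S B.
Proof.
rewrite -(@ler_pXn2r _ 2)// ?nnegrE ?mulr_ge0 ?qnorm_ge0//.
rewrite exprMn !qnorm_sqr real_normK ?num_real//.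
have pos t : 0 <= \tr (A *m S *m A^T) + 2 * t * \tr (A *m S *m B^T)
    + t ^+ 2 * \tr (B *m S *m B^T) by rewrite -formDZ form_ge0.
have := form_ge0 A; have := form_ge0 B.
move: pos; set a := \tr (A *m S *m A^T); set b := \tr (A *m S *m B^T).
set c := \tr (B *m S *m B^T) => pos c0 a0.
(* If the leading coefficient vanishes, so does [b]: otherwise the root [t] chosen below
   would give the polynomial the value [-1]. *)
have [c_eq0|c_neq0] := eqVneq c 0.
  have [->|b0] := eqVneq b 0; first by rewrite expr0n mulr_ge0.
  have := pos (- (a + 1) / (2 * b)).
  rewrite c_eq0 mulr0 addr0.
  have -> : 2 * (- (a + 1) / (2 * b)) * b = - (a + 1) by field.
  by lra.
have {c0 c_neq0} c0 : 0 < c by rewrite lt_neqAle eq_sym c_neq0.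
(* The minimum of the polynomial. *)
have := pos (- b / c).
have -> : a + 2 * (- b / c) * b + (- b / c) ^+ 2 * c = (a * c - b ^+ 2) / c.
  by field; rewrite gt_eqF.
by rewrite pmulr_lge0 ?invr_gt0// subr_ge0.
Qed.

Lemma qnorm_triangle m (A B : 'M[R]_(m, d)) :
  qnorm S (A + B) <= qnorm S A + qnorm S B.
Proof.
rewrite -(@ler_pXn2r _ 2)// ?nnegrE ?addr_ge0 ?qnorm_ge0//.
rewrite sqrrD !qnorm_sqr -[B in A + B]scale1r formDZ.
have := le_trans (ler_norm _) (form_cauchy_schwarz A B); lra.
Qed.

Lemma qnormN m (A : 'M[R]_(m, d)) : qnorm S (- A) = qnorm S A.
Proof. by rewrite /qnorm linearN/= mulNmx mulmxN mulNmx opprK. Qed.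

End Seminorm.

Lemma fnormE m d (A : 'M[R]_(m, d)) : fnorm A = qnorm 1%:M A.
Proof. by rewrite /qnorm mulmx1. Qed.

Lemma fnorm_triangle m d (A B : 'M[R]_(m, d)) :
  fnorm (A + B) <= fnorm A + fnorm B.
Proof. by rewrite !fnormE qnorm_triangle//; exact: form_ge1. Qed.

Lemma fnormN m d (A : 'M[R]_(m, d)) : fnorm (- A) = fnorm A.
Proof. by rewrite !fnormE qnormN. Qed.

Lemma fnormZ m d (a : R) (A : 'M[R]_(m, d)) : fnorm (a *: A) = `|a| * fnorm A.
Proof.
rewrite /fnorm linearZ/= -scalemxAl -scalemxAr scalerA mxtraceZ.
by rewrite sqrtrM -expr2 ?sqr_ge0// sqrtr_sqr.
Qed.

Lemma frobenius_cauchy_schwarz m d (A B : 'M[R]_(m, d)) :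
  `|\tr (A *m B^T)| <= fnorm A * fnorm B.
Proof.
by have := form_cauchy_schwarz (form_ge1 d) A B; rewrite mulmx1 -!fnormE.
Qed.

Lemma fnormM m d e (A : 'M[R]_(m, d)) (B : 'M[R]_(d, e)) :
  fnorm (A *m B) <= fnorm A * fnorm B.
Proof.
rewrite -(@ler_pXn2r _ 2)// ?nnegrE ?mulr_ge0 ?fnorm_ge0//.
rewrite exprMn -[fnorm B]fnorm_tr !fnorm_sqrE mulr_suml; apply: ler_sum => i _.
rewrite mulr_sumr; apply: ler_sum => j _.
have -> : (A *m B) i j = \tr (row i A *m (row j B^T)^T).
  by rewrite tr_mulmx_trE big_ord1 mxE; apply: eq_bigr => l _; rewrite !mxE.
have rowE p q (M : 'M[R]_(p, q)) l : \sum_r M l r ^+ 2 = fnorm (row l M) ^+ 2.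
  by rewrite fnorm_sqrE big_ord1; apply: eq_bigr => r _; rewrite mxE.
rewrite !rowE -exprMn -real_normK ?num_real// ler_pXn2r//.
  exact: frobenius_cauchy_schwarz.
by rewrite nnegrE mulr_ge0 ?fnorm_ge0.
Qed.

Lemma form_le_fnorm m d (D : 'M[R]_d) (A : 'M[R]_(m, d)) :
  `|\tr (A *m D *m A^T)| <= fnorm D * fnorm A ^+ 2.
Proof.
apply: le_trans (frobenius_cauchy_schwarz _ _) _.
by rewrite expr2 mulrA (mulrC (fnorm D)) ler_wpM2r ?fnorm_ge0// fnormM.
Qed.

Lemma form_ge_perturb d (S S' : 'M[R]_d) s t :
  S'^T = S' -> form_ge S s -> fnorm (S' - S) <= t -> form_ge S' (s - t).
Proof.
move=> symS' [_ Ss] St; split=> // m A.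
have -> : S' = S + (S' - S) by rewrite addrC subrK.
rewrite mulmxDr mulmxDl mxtraceD mulrBl.
apply: lerD; first exact: Ss.
have := form_le_fnorm (S' - S) A; rewrite ler_norml => /andP[+ _].
apply: le_trans; rewrite lerN2 -fnorm_sqr.
by rewrite ler_wpM2r ?sqr_ge0.
Qed.

(** The constraint of the problem: the rows of [A] are orthonormal for [S]. *)
Definition orthorows d (S : 'M[R]_d) k (A : 'M[R]_(k, d)) : Prop :=
  A *m S *m A^T = 1%:M.

(** Rows that are orthonormal for [S >= s] give [A] operator norm at most
[1 / sqrt s].  The hypothesis only speaks of [N |-> N^T A], so the bound on
[N = A M] comes by duality: [|N|^2 = <N^T A, M^T>]. *)
Lemma orthorows_mul_le d (S : 'M[R]_d) s k (A : 'M[R]_(k, d)) e (M : 'M[R]_(d, e)) :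
  0 < s -> form_ge S s -> orthorows S A ->
  s * fnorm (A *m M) ^+ 2 <= fnorm M ^+ 2.
Proof.
move=> s0 Ss AS; move NE : (A *m M) => N.
have NA : s * fnorm (N^T *m A) ^+ 2 <= fnorm N ^+ 2.
  have := Ss.2 _ (N^T *m A).
  rewrite -fnorm_sqr trmx_mul trmxK.
  rewrite -!mulmxA (mulmxA S) (mulmxA A (S *m _)) (mulmxA A S) AS mul1mx.
  by rewrite mxtrace_mulC -fnorm_sqr.
have NM : fnorm N ^+ 2 <= fnorm (N^T *m A) * fnorm M.
  have -> : fnorm N ^+ 2 = \tr ((N^T *m A) *m M).
    by rewrite fnorm_sqr mxtrace_mulC -mulmxA NE.
  rewrite -[M in leLHS]trmxK -[fnorm M]fnorm_tr.
  exact: le_trans (ler_norm _) (frobenius_cauchy_schwarz _ _).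
have := fnorm_ge0 N; have := fnorm_ge0 (N^T *m A); have := fnorm_ge0 M.
move: NA NM; move: (fnorm N) (fnorm _) (fnorm M) => n a m h1 h2 m0 a0 n0.
have [n_eq0|n_neq0] := eqVneq n 0.
  by rewrite n_eq0 expr0n mulr0 sqr_ge0.
have n2 : 0 < n ^+ 2 by rewrite exprn_even_gt0.
rewrite -(ler_pM2l n2).
have : n ^+ 2 * n ^+ 2 <= (a * m) ^+ 2.
  by rewrite -expr2 ler_pXn2r// ?nnegrE ?mulr_ge0// ltW.
rewrite exprMn => h3.
apply: (@le_trans _ _ (s * (a ^+ 2 * m ^+ 2))).
  by rewrite mulrCA ler_pM2l.
by rewrite mulrA ler_wpM2r ?sqr_ge0.
Qed.

(** Only one factor [fnorm D] appears: the operator norm of [A] bounds both products,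
so the number of rows does not enter. *)
Lemma orthorows_congr_le d (S : 'M[R]_d) s k (A : 'M[R]_(k, d)) (D : 'M[R]_d) :
  0 < s -> form_ge S s -> orthorows S A ->
  s * fnorm (A *m D *m A^T) <= fnorm D.
Proof.
move=> s0 Ss AS.
rewrite -(@ler_pXn2r _ 2)// ?nnegrE ?mulr_ge0 ?fnorm_ge0 ?(ltW s0)//.
rewrite -(fnorm_tr (_ *m _)) trmx_mul trmxK exprMn.
apply: le_trans (orthorows_mul_le D s0 Ss AS).
rewrite expr2 -mulrA ler_pM2l// -[in leRHS]fnorm_tr.
exact: orthorows_mul_le AS.
Qed.

Lemma orthorows_fnorm_le d (S : 'M[R]_d) s k (A : 'M[R]_(k, d)) :
  form_ge S s -> orthorows S A -> s * fnorm A ^+ 2 <= k%:R.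
Proof.
by move=> Ss AS; rewrite fnorm_sqr; apply: le_trans (Ss.2 _ A) _; rewrite AS mxtrace1.
Qed.

End MatrixForms.

(** * Minimizing continuous functions of a matrix *)

Section MatrixContinuity.
Context {R : realType} {T : topologicalType}.

(** Entrywise, so that products, traces and norms reduce to sums and products of
continuous real functions. *)
Definition entry_continuous m n (f : T -> 'M[R]_(m, n)) : Prop :=
  forall i j, continuous (fun t => f t i j).

Lemma continuous_sumr (I : finType) (F : I -> T -> R) :
  (forall i, continuous (F i)) -> continuous (fun t => \sum_i F i t).
Proof. by move=> cF; apply: continuous_big => //; exact: add_continuous. Qed.

Lemma continuous_addr (f g : T -> R) :
  continuous f -> continuous g -> continuous (fun t => f t + g t).
Proof. by move=> cf cg t; apply: cvgD; [exact: cf|exact: cg]. Qed.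

Lemma entry_continuous_cst m n (M : 'M[R]_(m, n)) : entry_continuous (fun=> M).
Proof. by move=> i j; exact: cst_continuous. Qed.

Lemma entry_continuous_tr m n (f : T -> 'M[R]_(m, n)) :
  entry_continuous f -> entry_continuous (fun t => (f t)^T).
Proof. by move=> cf i j; under eq_fun do rewrite mxE; exact: cf. Qed.

Lemma entry_continuousB m n (f g : T -> 'M[R]_(m, n)) :
  entry_continuous f -> entry_continuous g ->
  entry_continuous (fun t => f t - g t).
Proof.
move=> cf cg i j; under eq_fun do rewrite !mxE.
by move=> t; apply: cvgB; [exact: cf|exact: cg].
Qed.

Lemma entry_continuousM m n p (f : T -> 'M[R]_(m, n)) (g : T -> 'M[R]_(n, p)) :
  entry_continuous f -> entry_continuous g ->
  entry_continuous (fun t => f t *m g t).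
Proof.
move=> cf cg i j; under eq_fun do rewrite mxE.
by apply: continuous_sumr => l t; apply: cvgM; [exact: cf|exact: cg].
Qed.

Lemma continuous_mxtrace n (f : T -> 'M[R]_n) :
  entry_continuous f -> continuous (fun t => \tr (f t)).
Proof. by move=> cf; apply: continuous_sumr => i; exact: cf. Qed.

Lemma continuous_qnorm m n (S : 'M[R]_n) (f : T -> 'M[R]_(m, n)) :
  entry_continuous f -> continuous (fun t => qnorm S (f t)).
Proof.
move=> cf t.
have cform : continuous (fun t => \tr (f t *m S *m (f t)^T)).
  apply: continuous_mxtrace.
  apply: entry_continuousM; last exact: entry_continuous_tr.
  by apply: entry_continuousM => //; exact: entry_continuous_cst.
exact: (continuous_comp (cform t) (@sqrt_continuous R _)).
Qed.

Lemma continuous_fnorm m n (f : T -> 'M[R]_(m, n)) :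
  entry_continuous f -> continuous (fun t => fnorm (f t)).
Proof.
by move=> cf; under eq_fun do rewrite fnormE; exact: continuous_qnorm.
Qed.

End MatrixContinuity.

Section Minimum.
Context {R : realType}.

Lemma entry_continuous_vec_mx m n :
  entry_continuous (vec_mx : 'rV[R]_(m * n) -> 'M[R]_(m, n)).
Proof.
by move=> i j; under eq_fun do rewrite mxE; exact: coord_continuous.
Qed.

Lemma normr_entry_le_fnorm m n (A : 'M[R]_(m, n)) i j : `|A i j| <= fnorm A.
Proof.
rewrite -(@ler_pXn2r _ 2)// ?nnegrE ?fnorm_ge0// fnorm_sqrE.
rewrite real_normK ?num_real// (bigD1 i)//= (bigD1 j)//= -addrA lerDl.
by apply: addr_ge0; do 2?[apply: sumr_ge0 => ? _]; rewrite ?sqr_ge0.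
Qed.

Lemma fnorm_vec_mx m n (v : 'rV[R]_(m * n)) : fnorm (vec_mx v) = fnorm v.
Proof.
apply/eqP; rewrite -(eqrXn2 (n := 2))// ?fnorm_ge0//; apply/eqP.
rewrite !fnorm_sqrE big_ord1 pair_big/= -[in RHS](vec_mxK v).
rewrite (reindex _ (curry_mxvec_bij m n))/=.
by apply: eq_bigr => -[i j] _; rewrite mxvecE.
Qed.

(** The map [vec_mx] preserves the Frobenius norm and transports the problem to row
vectors, where closed bounded sets are compact. *)
Lemma fnorm_bounded_closed_min m n (K : set 'M[R]_(m, n)) (g : 'M[R]_(m, n) -> R) r :
  K !=set0 -> closed (vec_mx @^-1` K) -> (forall A, K A -> fnorm A <= r) ->
  continuous (g \o vec_mx) ->
  exists2 c, K c & forall A, K A -> g c <= g A.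
Proof.
move=> [A0 KA0] clK Kr cg.
have cptK : compact (vec_mx @^-1` K : set 'rV[R]_(m * n)).
  apply: bounded_closed_compact => //.
  exists r; split; first exact: num_real.
  move=> x rx v /Kr; rewrite fnorm_vec_mx => vr.
  suff : `|v| <= x by [].
  rewrite [leLHS]/Num.norm/= mx_normrE; apply: bigmax_le => [|i _].
    exact: le_trans (fnorm_ge0 v) (le_trans vr (ltW rx)).
  exact: le_trans (normr_entry_le_fnorm _ _ _) (le_trans vr (ltW rx)).
have [|c /[!inE] Kc gc] := compact_EVT_min _ cptK (continuous_subspaceT cg).
  by exists (mxvec A0); rewrite /preimage/= mxvecK.
exists (vec_mx c) => // A KA.
by have := gc (mxvec A); rewrite inE /preimage/= mxvecK; exact.
Qed.

Lemma fnorm_bounded_sublevel_min m n (g h : 'M[R]_(m, n) -> R) r :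
  (exists A, h A <= 0) -> (forall A, h A <= 0 -> fnorm A <= r) ->
  continuous (g \o vec_mx) -> continuous (h \o vec_mx) ->
  exists2 c, h c <= 0 & forall A, h A <= 0 -> g c <= g A.
Proof.
move=> h0 hr cg ch.
apply: (@fnorm_bounded_closed_min _ _ [set A | h A <= 0]) hr cg => //.
have := preimage_closed (f := h \o vec_mx) _ (@closed_le R 0).
by apply=> x _; exact: ch.
Qed.

End Minimum.

(** * Orthonormal rows for a quadratic form *)

Section OrthonormalRows.
Context {R : realType}.

(** The map [B |-> (1 - F) B] is one step of the Newton iteration for the equation
[B S B^T = 1]: writing the defect of [B] as [2 F], the defect of the image is
[(1 - F) (1 + 2 F) (1 - F) - 1 = 2 F^3 - 3 F^2], quadratic in [F], while the step
has length about [|F|], half the defect, in the seminorm of [S]. *)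
Lemma newton_step d (S : 'M[R]_d) k (B : 'M[R]_(k, d)) (F : 'M[R]_k) :
  form_ge S 0 -> B *m S *m B^T = 1%:M + 2 *: F ->
  fnorm ((B - F *m B) *m S *m (B - F *m B)^T - 1%:M)
    <= 3 * fnorm F ^+ 2 + 2 * fnorm F ^+ 3 /\
  qnorm S (F *m B) <= fnorm F + fnorm F ^+ 2.
Proof.
move=> S0 BF.
have symF : F^T = F.
  have : (1%:M + 2 *: F)^T = 1%:M + 2 *: F.
    by rewrite -BF !trmx_mul trmxK S0.1 mulmxA.
  rewrite linearD/= linearZ/= trmx1 => /addrI; apply: scalerI.
  by rewrite pnatr_eq0.
have f0 := fnorm_ge0 F.
have FF : fnorm (F *m F) <= fnorm F ^+ 2 by rewrite expr2; exact: fnormM.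
have congrF (G : 'M[R]_k) : (G *m B) *m S *m (G *m B)^T =
    G *m G^T + 2 *: (G *m F *m G^T).
  rewrite trmx_mul !mulmxA -(mulmxA G) -(mulmxA G) BF.
  by rewrite mulmxDr mulmx1 mulmxDl -scalemxAr -scalemxAl.
split.
  have -> : (B - F *m B) *m S *m (B - F *m B)^T - 1%:M =
      2 *: (F *m F *m F) - 3 *: (F *m F).
    have -> : B - F *m B = (1%:M - F) *m B by rewrite mulmxBl mul1mx.
    rewrite congrF linearB/= trmx1 symF.
    rewrite !(mulmxBl, mulmxBr) !(mul1mx, mulmx1).
    move: (F *m F *m F) (F *m F) => F3 F2.
    by apply/matrixP => i j; rewrite !mxE; ring.
  apply: le_trans (fnorm_triangle _ _) _.
  rewrite fnormN !fnormZ !ger0_norm// addrC; apply: lerD; rewrite ler_pM2l//.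
  by rewrite exprSr; apply: le_trans (fnormM _ _) _; rewrite ler_wpM2r.
rewrite -(@ler_pXn2r _ 2)// ?nnegrE ?addr_ge0 ?exprn_ge0 ?qnorm_ge0//.
rewrite qnorm_sqr// congrF symF mxtraceD mxtraceZ.
have -> : \tr (F *m F) = fnorm F ^+ 2 by rewrite fnorm_sqr symF.
have F3 : \tr (F *m F *m F) <= fnorm F ^+ 2 * fnorm F.
  rewrite -[X in _ *m X]symF.
  apply: le_trans (le_trans (ler_norm _) (frobenius_cauchy_schwarz _ _)) _.
  by rewrite ler_wpM2r.
have f4 : 0 <= (fnorm F ^+ 2) ^+ 2 by rewrite sqr_ge0.
by rewrite sqrrD; lra.
Qed.

(** A minimizer [B] of [defect B + qnorm S (B - A)] is feasible: otherwise a Newton step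
would reduce the defect by more than it increases the distance to [A].  Comparing
its cost with that of [A] bounds the distance.  The point [B] plays the
role of [(A S A^T)^(-1/2) A]. *)
Lemma orthorows_near d (S : 'M[R]_d) s k (A : 'M[R]_(k, d)) :
  0 < s -> form_ge S s -> fnorm (A *m S *m A^T - 1%:M) <= 4^-1 ->
  exists2 B, orthorows S B & qnorm S (B - A) <= fnorm (A *m S *m A^T - 1%:M).
Proof.
move=> s0 Ss Ae; have S0 : form_ge S 0 := form_geW (ltW s0) Ss.
pose defect (B : 'M[R]_(k, d)) := fnorm (B *m S *m B^T - 1%:M).
pose cost B := defect B + qnorm S (B - A).
have defect_cont : continuous (defect \o vec_mx).
  apply: continuous_fnorm; apply: entry_continuousB; last exact: entry_continuous_cst.
  apply: entry_continuousM; last exact/entry_continuous_tr/entry_continuous_vec_mx.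
  apply: entry_continuousM; first exact: entry_continuous_vec_mx.
  exact: entry_continuous_cst.
have dist_cont : continuous ((fun B => qnorm S (B - A)) \o vec_mx).
  apply: continuous_qnorm; apply: entry_continuousB; last exact: entry_continuous_cst.
  exact: entry_continuous_vec_mx.
have cost_cont : continuous (cost \o vec_mx).
  exact: (continuous_addr (f := defect \o vec_mx) (g := (fun B => qnorm S (B - A)) \o vec_mx)).
have costA : cost A = defect A.
  by rewrite /cost subrr /qnorm mul0mx mul0mx mxtrace0 sqrtr0 addr0.
have [||||B Bd Bmin] := @fnorm_bounded_sublevel_min R k d cost
    (fun B => cost B - 4^-1) (fnorm A + (1 + (16 * s)^-1)).
- by exists A; rewrite costA subr_le0.
- move=> B; rewrite subr_le0 => costB.
  rewrite -[B](subrK A) addrC; apply: le_trans (fnorm_triangle _ _) _.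
  rewrite lerD2l.
  have q4 : qnorm S (B - A) ^+ 2 <= 4^-1 ^+ 2.
    rewrite ler_pXn2r// ?nnegrE ?qnorm_ge0// ?invr_ge0//.
    by apply: le_trans costB; rewrite lerDr fnorm_ge0.
  have := Ss.2 _ (B - A); rewrite -qnorm_sqr// -fnorm_sqr => /le_trans/(_ q4).
  move: (fnorm _) (fnorm_ge0 (B - A)) => x x0.
  rewrite mulrC -ler_pdivlMr// => hx.
  have -> : (16 * s)^-1 = 4^-1 ^+ 2 / s by field; rewrite gt_eqF.
  by nra.
- exact: cost_cont.
- by apply: (continuous_addr (f := cost \o vec_mx)) => //; exact: cst_continuous.
have {Bmin} Bmin B' : cost B <= cost B'.
  have [le4|/ltW gt4] := leP (cost B') 4^-1; first by apply: Bmin; rewrite subr_le0.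
  by rewrite subr_le0 in Bd; exact: le_trans Bd gt4.
have BA : cost B <= defect A by rewrite -costA.
have dB0 : defect B = 0.
  (* With [f = |F| <= 1/8] a step costs [f + f^2] and brings the defect [2 f] down to
     [3 f^2 + 2 f^3]; minimality would give [f <= 4 f^2 + 2 f^3], forcing [f = 0]. *)
  pose F := 2^-1 *: (B *m S *m B^T - 1%:M).
  have BF : B *m S *m B^T = 1%:M + 2 *: F.
    by rewrite scalerA mulfV ?pnatr_eq0// scale1r addrC subrK.
  have [dB' stepB] := newton_step S0 BF.
  have defF : defect B = 2 * fnorm F.
    by rewrite /F fnormZ ger0_norm ?invr_ge0// mulrA mulfV ?pnatr_eq0// mul1r.
  have tri : qnorm S (B - F *m B - A) <= qnorm S (F *m B) + qnorm S (B - A).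
    rewrite -(qnormN S (F *m B)) addrAC addrC.
    exact: qnorm_triangle.
  have := Bmin (B - F *m B); rewrite /cost {1}defF.
  have F8 : fnorm F <= 8^-1.
    have : defect B <= 4^-1.
      apply: le_trans (le_trans BA Ae).
      by rewrite /cost lerDl qnorm_ge0.
    by rewrite defF; lra.
  move=> minB; rewrite defF.
  have : 2 * fnorm F <= 3 * fnorm F ^+ 2 + 2 * fnorm F ^+ 3 + (fnorm F + fnorm F ^+ 2).
    rewrite /defect in minB; lra.
  have := fnorm_ge0 F; move: (fnorm F) F8 => f f8 f0 h.
  by nra.
exists B.
  by apply/eqP; rewrite -subr_eq0 -fnorm_eq0; apply/eqP.
by move: BA; rewrite /cost dB0 add0r.
Qed.

(** Gram-Schmidt: as long as there are fewer rows than columns, the kernel of [S A^T]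
contains a nonzero vector, which can be normalized and appended. *)
Lemma orthorows_exists d (S : 'M[R]_d) s k :
  0 < s -> form_ge S s -> (k <= d)%N ->
  exists A : 'M[R]_(k, d), orthorows S A.
Proof.
move=> s0 Ss; elim: k => [|k IHk] kd.
  by exists 0; apply/matrixP => -[].
have [A AS] := IHk (ltnW kd).
have : kermx (S *m A^T) != 0.
  rewrite -mxrank_eq0 mxrank_ker -lt0n subn_gt0.
  exact: leq_ltn_trans (rank_leq_col _) kd.
move=> /rowV0Pn[v /sub_kermxP vSA v0].
have vSv : 0 < \tr (v *m S *m v^T).
  apply: lt_le_trans (Ss.2 _ v); rewrite mulr_gt0// -fnorm_sqr.
  by rewrite exprn_even_gt0//= fnorm_eq0.
move: vSv; set q := \tr _ => q0.
pose u := (Num.sqrt q)^-1 *: v.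
have uSA : u *m S *m A^T = 0 by rewrite -!scalemxAl -mulmxA vSA scaler0.
have uSu : u *m S *m u^T = 1%:M.
  rewrite linearZ/= -scalemxAr -!scalemxAl scalerA -expr2 exprVn sqr_sqrtr ?ltW//.
  apply/matrixP => i j; rewrite !ord1 mxE [in LHS](_ : _ 0 0 = q).
    by rewrite mulVf ?gt_eqF// mxE.
  by rewrite /q /mxtrace big_ord1.
rewrite -addn1; exists (col_mx A u).
rewrite /orthorows mul_col_mx tr_col_mx mul_col_row AS uSA uSu.
have -> : A *m S *m u^T = 0.
  by apply: trmx_inj; rewrite trmx0 !trmx_mul trmxK Ss.1 mulmxA uSA.
by rewrite -scalar_mx_block.
Qed.

Lemma form_ge_rows d (S : 'M[R]_d) s : S^T = S ->
  (forall u : 'rV[R]_d, s * \tr (u *m u^T) <= \tr (u *m S *m u^T)) ->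
  form_ge S s.
Proof.
move=> symS Ss; split=> // m A.
have row_form (T : 'M[R]_d) :
    \tr (A *m T *m A^T) = \sum_i \tr (row i A *m T *m (row i A)^T).
  apply: eq_bigr => i _.
  by rewrite /mxtrace big_ord1 -row_mul !mxE; apply: eq_bigr => j _; rewrite !mxE.
have := row_form 1%:M; rewrite mulmx1 => ->.
rewrite row_form mulr_sumr; apply: ler_sum => i _.
by rewrite mulmx1; exact: Ss.
Qed.

(** A minimizer [c] of the quadratic form on the unit sphere is an eigenvector: the form
of [N = S - form c] is positive semidefinite and vanishes at [c], hence [c N = 0] by
Cauchy-Schwarz.  The hypothesis [0 < s] rules out the default value [0] that [inf]
takes on a set that is empty or unbounded below. *)
Lemma lambda_min_form_ge d (S : 'M[R]_d) s :
  0 < s -> S^T = S -> s <= inf [set a | eigenvalue S a] -> form_ge S s.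
Proof.
move=> s0 symS s_le.
have eig_ge a : eigenvalue S a -> s <= a.
  move=> Sa; apply: le_trans (s_le) _; apply: ge_inf => //.
  have [//|noinf] := pselect (has_inf [set a | eigenvalue S a]).
    by case.
  by move: s_le; rewrite inf_out// leNgt s0.
apply: form_ge_rows => // v.
have [->|v0] := eqVneq v 0; first by rewrite !mul0mx mxtrace0 mulr0.
pose form (u : 'rV[R]_d) := \tr (u *m S *m u^T).
have form_cont : continuous (form \o vec_mx).
  apply: continuous_mxtrace.
  apply: entry_continuousM; last exact/entry_continuous_tr/entry_continuous_vec_mx.
  apply: entry_continuousM; first exact: entry_continuous_vec_mx.
  exact: entry_continuous_cst.
have norm_cont : continuous ((fun u : 'rV[R]_d => fnorm u) \o vec_mx).
  by apply: continuous_fnorm; exact: entry_continuous_vec_mx.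
have normalize (u : 'rV[R]_d) : u != 0 -> fnorm ((fnorm u)^-1 *: u) = 1.
  rewrite -fnorm_eq0 => u0; rewrite fnormZ ger0_norm ?invr_ge0 ?fnorm_ge0//.
  by rewrite mulVf.
have [||||c /= c1 cmin] := @fnorm_bounded_closed_min R 1 d
    [set u | fnorm u = 1] form 1.
- by exists ((fnorm v)^-1 *: v); exact: normalize.
- have := preimage_closed (f := (fun u : 'rV[R]_d => fnorm u) \o vec_mx) _ (@closed_eq R 1).
  by apply=> x _; exact: norm_cont.
- by move=> A /= ->.
- exact: form_cont.
pose N := S - (form c)%:M.
have NE m (A B : 'M[R]_(m, d)) :
    \tr (A *m N *m B^T) = \tr (A *m S *m B^T) - form c * \tr (A *m B^T).
  rewrite mulmxBr mulmxBl mul_mx_scalar -scalemxAl.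
  by rewrite raddfB/= mxtraceZ.
have N0 : form_ge N 0.
  apply: form_ge_rows => [|u].
    by rewrite linearB/= symS tr_scalar_mx.
  rewrite mul0r NE subr_ge0.
  have [->|u0] := eqVneq u 0; first by rewrite !mul0mx mxtrace0 mulr0.
  have := cmin _ (normalize u u0).
  rewrite {2}/form linearZ/= -scalemxAr -!scalemxAl scalerA mxtraceZ.
  rewrite -fnorm_sqr -expr2 exprVn mulrC ler_pdivlMr//.
  by rewrite exprn_even_gt0//= fnorm_eq0.
have cN : c *m N = 0.
  apply/eqP; rewrite -fnorm_eq0 -sqrf_eq0 fnorm_sqr -normr_le0.
  apply: le_trans (form_cauchy_schwarz N0 c (c *m N)) _.
  by rewrite {1}/qnorm NE -fnorm_sqr c1 expr1n mulr1 subrr sqrtr0 mul0r.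
have s_form : s <= form c.
  apply: eig_ge; apply/eigenvalueP; exists c.
    by apply/eqP; rewrite -subr_eq0 -mul_mx_scalar -mulmxBr; apply/eqP.
  by rewrite -fnorm_eq0 c1 oner_eq0.
have := form_ge0 N0 v; rewrite NE subr_ge0; apply: le_trans.
by rewrite ler_wpM2r// tr_mulmx_ge0.

Qed.

End OrthonormalRows.

(** * The optimization problem as a function of the joint covariance *)

Section PairProblem.
Context {R : realType} {k d1 d2 : nat}.
Implicit Types (S : 'M[R]_(d1 + d2)) (A : 'M[R]_(k, d1) * 'M[R]_(k, d2)).

(** The matrix of [(x1, x2) |-> A.1 x1 - A.2 x2], the vector whose mean square is the
objective. *)
Definition signed_row A : 'M[R]_(k, d1 + d2) := row_mx A.1 (- A.2).

Definition pair_objective S A : R :=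
  \tr (signed_row A *m S *m (signed_row A)^T).

Definition pair_feasible S : set ('M[R]_(k, d1) * 'M[R]_(k, d2)) :=
  [set A | orthorows (ulsubmx S) A.1 /\ orthorows (drsubmx S) A.2].

Definition blocks_ge S s : Prop :=
  [/\ form_ge S 0, form_ge (ulsubmx S) s & form_ge (drsubmx S) s].

Lemma orthorowsN d (S : 'M[R]_d) (A : 'M[R]_(k, d)) :
  orthorows S A -> orthorows S (- A).
Proof. by rewrite /orthorows linearN/= mulNmx mulmxN mulNmx opprK. Qed.

Lemma qnorm_row0 S (Z : 'M[R]_(k, d1)) :
  qnorm S (row_mx Z 0) = qnorm (ulsubmx S) Z.
Proof.
rewrite /qnorm -[S in LHS]submxK mul_row_block !mul0mx !addr0 tr_row_mx trmx0.
by rewrite mul_row_col mulmx0 addr0.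
Qed.

Lemma qnorm_0row S (Z : 'M[R]_(k, d2)) :
  qnorm S (row_mx 0 Z) = qnorm (drsubmx S) Z.
Proof.
rewrite /qnorm -[S in LHS]submxK mul_row_block !mul0mx !add0r tr_row_mx trmx0.
by rewrite mul_row_col mulmx0 add0r.
Qed.

Lemma fnorm_row_mx (Z1 : 'M[R]_(k, d1)) (Z2 : 'M[R]_(k, d2)) :
  fnorm (row_mx Z1 Z2) ^+ 2 = fnorm Z1 ^+ 2 + fnorm Z2 ^+ 2.
Proof. by rewrite !fnorm_sqr tr_row_mx mul_row_col mxtraceD. Qed.

Lemma fnorm_ulsubmx S : fnorm (ulsubmx S) <= fnorm S.
Proof.
rewrite -(@ler_pXn2r _ 2)// ?nnegrE ?fnorm_ge0// !fnorm_sqrE big_split_ord/=.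
rewrite ler_wpDr//; first by do 2![apply: sumr_ge0 => ? _]; exact: sqr_ge0.
apply: ler_sum => i _; rewrite big_split_ord/= ler_wpDr//.
  by apply: sumr_ge0 => ? _; exact: sqr_ge0.
by apply: ler_sum => j _; rewrite !mxE.
Qed.

Lemma fnorm_drsubmx S : fnorm (drsubmx S) <= fnorm S.
Proof.
rewrite -(@ler_pXn2r _ 2)// ?nnegrE ?fnorm_ge0// !fnorm_sqrE big_split_ord/=.
rewrite ler_wpDl//; first by do 2![apply: sumr_ge0 => ? _]; exact: sqr_ge0.
apply: ler_sum => i _; rewrite big_split_ord/= ler_wpDl//.
  by apply: sumr_ge0 => ? _; exact: sqr_ge0.
by apply: ler_sum => j _; rewrite !mxE.
Qed.

Lemma signed_row_fnorm_le S s A :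
  form_ge (ulsubmx S) s -> form_ge (drsubmx S) s -> pair_feasible S A ->
  s * fnorm (signed_row A) ^+ 2 <= 2 * k%:R.
Proof.
move=> S1 S2 [A1 A2]; rewrite fnorm_row_mx fnormN mulrDr.
by have := orthorows_fnorm_le S1 A1; have := orthorows_fnorm_le S2 A2; lra.
Qed.

(** The feasible set is nonempty by Gram-Schmidt, and compact because [blocks_ge]
bounds it.  The minimization runs over the row matrix [[A1, - A2]], on which the
objective is a quadratic form. *)
Lemma pair_min_exists S s : (k <= minn d1 d2)%N -> 0 < s -> blocks_ge S s ->
  exists m, is_min (pair_feasible S) (pair_objective S) m.
Proof.
rewrite leq_min => /andP[k1 k2] s0 [S0 S1 S2].
have cid := @entry_continuous_vec_mx R k (d1 + d2).
have cl : entry_continuous (lsubmx \o @vec_mx R k (d1 + d2)).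
  by move=> i j; under eq_fun do rewrite mxE; exact: cid.
have cr : entry_continuous (rsubmx \o @vec_mx R k (d1 + d2)).
  by move=> i j; under eq_fun do rewrite mxE; exact: cid.
have cform d (T : 'M[R]_d) (f : 'rV[R]_(k * (d1 + d2)) -> 'M[R]_(k, d)) :
    entry_continuous f -> entry_continuous (fun v => f v *m T *m (f v)^T).
  move=> cf; apply: entry_continuousM; last exact: entry_continuous_tr.
  by apply: entry_continuousM => //; exact: entry_continuous_cst.
pose form (J : 'M[R]_(k, d1 + d2)) := \tr (J *m S *m J^T).
pose defect (J : 'M[R]_(k, d1 + d2)) :=
  fnorm (lsubmx J *m ulsubmx S *m (lsubmx J)^T - 1%:M) +
  fnorm (rsubmx J *m drsubmx S *m (rsubmx J)^T - 1%:M).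
have defect0P J : defect J <= 0 <->
    orthorows (ulsubmx S) (lsubmx J) /\ orthorows (drsubmx S) (rsubmx J).
  rewrite /defect; split=> [|[-> ->]]; last first.
    by rewrite !subrr /fnorm !mul0mx !mxtrace0 sqrtr0 addr0.
  have := fnorm_ge0 (lsubmx J *m ulsubmx S *m (lsubmx J)^T - 1%:M).
  have := fnorm_ge0 (rsubmx J *m drsubmx S *m (rsubmx J)^T - 1%:M).
  move=> r0 l0 lr0; split; apply/eqP; rewrite -subr_eq0 -fnorm_eq0 eq_le.
    by rewrite l0 andbT; lra.
  by rewrite r0 andbT; lra.
have [||||J /defect0P[J1 J2] Jmin] := @fnorm_bounded_sublevel_min R _ _ form defect
    (1 + 2 * k%:R / s).
- have [A1 A1S] := orthorows_exists s0 S1 k1.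
  have [A2 A2S] := orthorows_exists s0 S2 k2.
  by exists (row_mx A1 A2); apply/defect0P; rewrite row_mxKl row_mxKr.
- move=> J /defect0P[J1 J2].
  have := @signed_row_fnorm_le S s (lsubmx J, - rsubmx J) S1 S2.
  rewrite /signed_row/= opprK hsubmxK => /(_ (conj J1 (orthorowsN J2))).
  move: (fnorm _) => x; rewrite mulrC -ler_pdivlMr// => hx.
  by nra.
- by apply: continuous_mxtrace; exact: cform.
- have cdefect d (T : 'M[R]_d) (f : 'rV[R]_(k * (d1 + d2)) -> 'M[R]_(k, d)) :
      entry_continuous f -> continuous (fun v => fnorm (f v *m T *m (f v)^T - 1%:M)).
    move=> cf; apply: continuous_fnorm; apply: entry_continuousB; first exact: cform.
    exact: entry_continuous_cst.
  exact: continuous_addr (cdefect _ (ulsubmx S) _ cl) (cdefect _ (drsubmx S) _ cr).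
exists (form J); split.
  exists (lsubmx J, - rsubmx J); first by split=> //; exact: orthorowsN.
  by rewrite /pair_objective /signed_row/= opprK hsubmxK.
move=> A [A1 A2]; apply: (Jmin (signed_row A)); apply/defect0P.
by rewrite row_mxKl row_mxKr; split=> //; exact: orthorowsN.
Qed.

Lemma pair_objective_le S A : form_ge S 0 -> pair_feasible S A ->
  pair_objective S A <= 4 * k%:R.
Proof.
move=> S0 [A1 A2]; rewrite /pair_objective -qnorm_sqr//.
have -> : signed_row A = row_mx A.1 0 + row_mx 0 (- A.2).
  by rewrite add_row_mx addr0 add0r.
have := qnorm_triangle S0 (row_mx A.1 0) (row_mx 0 (- A.2)).
rewrite qnorm_row0 qnorm_0row qnormN {2 3}/qnorm A1 A2 mxtrace1 => tri.
have k0 : 0 <= k%:R :> R by [].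
apply: (@le_trans _ _ ((Num.sqrt k%:R + Num.sqrt k%:R) ^+ 2)).
  by rewrite ler_pXn2r// nnegrE ?qnorm_ge0// addr_ge0// sqrtr_ge0.
have -> : (Num.sqrt k%:R + Num.sqrt k%:R) ^+ 2 = 4 * Num.sqrt k%:R ^+ 2 :> R by ring.
by rewrite sqr_sqrtr.
Qed.

(** Each block of [A] is moved to a nearby feasible point for [S'].  Three errors add up:
[2 k t] for replacing [S] by [S'] in the objective, and [12 k t + k t] from the
expansion of [(q + 2 t)^2], where [q <= 3 k] is the seminorm of [A]. *)
Lemma pair_perturb S S' s s' t A : (0 < k)%N -> 0 < s -> 0 < s' -> t <= 4^-1 ->
  blocks_ge S s -> blocks_ge S' s' -> fnorm (S' - S) <= s * t ->
  pair_feasible S A ->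
  exists2 B, pair_feasible S' B &
    pair_objective S' B <= pair_objective S A + 15 * k%:R * t.
Proof.
move=> k_gt0 s0 s'0 t4 [S0 S1 S2] [S'0 S'1 S'2] SS' SA; have [A1 A2] := SA.
have near d (T T' : 'M[R]_d) (Z : 'M[R]_(k, d)) :
    form_ge T s -> form_ge T' s' -> fnorm (T' - T) <= s * t -> orthorows T Z ->
    exists2 B, orthorows T' B & qnorm T' (B - Z) <= t.
  move=> Ts T's' TT' TZ.
  have Zt : fnorm (Z *m T' *m Z^T - 1%:M) <= t.
    rewrite -TZ -mulmxBl -mulmxBr -(ler_pM2l s0).
    exact: le_trans (orthorows_congr_le _ s0 Ts TZ) TT'.
  have [B TB BZ] := orthorows_near s'0 T's' (le_trans Zt t4).
  by exists B => //; exact: le_trans BZ Zt.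
have [B1 B1S B1A] : exists2 B, orthorows (ulsubmx S') B &
    qnorm (ulsubmx S') (B - A.1) <= t.
  apply: near A1 => //; rewrite (_ : _ - _ = ulsubmx (S' - S)).
    exact: le_trans (fnorm_ulsubmx _) SS'.
  by apply/matrixP => i j; rewrite !mxE.
have [B2 B2S B2A] : exists2 B, orthorows (drsubmx S') B &
    qnorm (drsubmx S') (B - A.2) <= t.
  apply: near A2 => //; rewrite (_ : _ - _ = drsubmx (S' - S)).
    exact: le_trans (fnorm_drsubmx _) SS'.
  by apply/matrixP => i j; rewrite !mxE.
exists (B1, B2) => //.
have t0 : 0 <= t.
  by have := le_trans (fnorm_ge0 _) SS'; rewrite pmulr_rge0.
have objA' : pair_objective S' A <= pair_objective S A + 2 * k%:R * t.
  have -> : S' = S + (S' - S) by rewrite addrC subrK.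
  rewrite /pair_objective mulmxDr mulmxDl mxtraceD lerD2l.
  apply: le_trans (le_trans (ler_norm _) (form_le_fnorm _ _)) _.
  apply: (@le_trans _ _ (s * t * fnorm (signed_row A) ^+ 2)).
    by rewrite ler_wpM2r// sqr_ge0.
  by rewrite mulrAC ler_wpM2r//; exact: signed_row_fnorm_le S1 S2 SA.
have qB : qnorm S' (signed_row (B1, B2)) <= qnorm S' (signed_row A) + (t + t).
  have -> : signed_row (B1, B2) =
      signed_row A + (row_mx (B1 - A.1) 0 + row_mx 0 (- (B2 - A.2))).
    rewrite /signed_row !add_row_mx/= addr0 add0r opprB.
    by rewrite addKr addrC subrK.
  apply: le_trans (qnorm_triangle S'0 _ _) _; rewrite lerD2l.
  apply: le_trans (qnorm_triangle S'0 _ _) _.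
  by rewrite qnorm_row0 qnorm_0row qnormN; exact: lerD.
have objA := pair_objective_le S0 SA.
rewrite /pair_objective -!qnorm_sqr// in objA objA' *.
have k1 : 1 <= k%:R :> R by rewrite ler1n.
move: objA objA' qB k1 (qnorm_ge0 S' (signed_row (B1, B2))) (qnorm_ge0 S' (signed_row A)).
move: (qnorm S' (signed_row (B1, B2))) (qnorm S' _) (qnorm S _) (k%:R) => b a c x.
move=> c4 ac ba x1 b0 a0.
have a3 : a <= 3 * x by nra.
have b2 : b ^+ 2 <= (a + (t + t)) ^+ 2.
  by rewrite ler_pXn2r// nnegrE ?addr_ge0.
(* [a], [b] and [c] are the seminorms of the old point for [S'], of the new point for
   [S'] and of the old point for [S]; [x] is [k]. *)
have at3 : a * t <= 3 * x * t by rewrite ler_wpM2r.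
have tt : t * t <= 4^-1 * t by rewrite ler_wpM2r.
have xt : t <= x * t by rewrite ler_peMl.
by move: b2; rewrite sqrrD; nra.
Qed.

(** Perturbation from [S] to [S'] and back.  The way back has only the lower bound
[s / 2] for the blocks of [S'], whence the relative distance [2 t] and the
constant [30]. *)
Lemma pair_min_close S S' s t m :
  (0 < k)%N -> (k <= minn d1 d2)%N -> 0 < s -> t <= 8^-1 ->
  blocks_ge S s -> form_ge S' 0 -> fnorm (S' - S) <= s * t ->
  is_min (pair_feasible S) (pair_objective S) m ->
  exists2 m', is_min (pair_feasible S') (pair_objective S') m' &
    `|m' - m| <= 30 * k%:R * t.
Proof.
move=> k0 kd s0 t8 Ss S'0 SS' [[A SA <-] Amin].
have t0 : 0 <= t by have := le_trans (fnorm_ge0 _) SS'; rewrite pmulr_rge0.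
have st : s * t <= s / 2.
  by rewrite ler_pM2l//; apply: le_trans t8 _; lra.
have halve d (V V' : 'M[R]_d) :
    form_ge V s -> V'^T = V' -> fnorm (V' - V) <= s * t -> form_ge V' (s / 2).
  move=> Vs symV' VV'; have := form_ge_perturb symV' Vs (le_trans VV' st).
  by apply: form_geW; lra.
have S's : blocks_ge S' (s / 2).
  have [_ S1 S2] := Ss; have [symS' _] := S'0.
  split=> //.
  - apply: (halve _ _ _ S1); first by rewrite -[in RHS]symS' trmx_ulsub.
    rewrite (_ : _ - _ = ulsubmx (S' - S)); last by apply/matrixP => i j; rewrite !mxE.
    exact: le_trans (fnorm_ulsubmx _) SS'.
  - apply: (halve _ _ _ S2); first by rewrite -[in RHS]symS' trmx_drsub.
    rewrite (_ : _ - _ = drsubmx (S' - S)); last by apply/matrixP => i j; rewrite !mxE.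
    exact: le_trans (fnorm_drsubmx _) SS'.
have s20 : 0 < s / 2 by rewrite divr_gt0.
have [m' minS'] := pair_min_exists kd s20 S's.
exists m' => //; case: minS' => -[A' SA' <-] A'min.
have t4 : t <= 4^-1 by apply: le_trans t8 _; lra.
have [B SB BA] := pair_perturb k0 s0 s20 t4 Ss S's SS' SA.
have t24 : 2 * t <= 4^-1 by lra.
have S'S : fnorm (S - S') <= s / 2 * (2 * t).
  by rewrite -fnormN opprB (_ : s / 2 * (2 * t) = s * t)//; field.
have [B' SB' B'A'] := pair_perturb k0 s20 s0 t24 S's Ss S'S SA'.
have := A'min _ SB; have := Amin _ SB'.
have k0' : 0 <= k%:R * t by rewrite mulr_ge0.
rewrite ler_norml => h1 h2; apply/andP; split; lra.
Qed.

End PairProblem.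

(** * Mean operators and covariance matrices *)

Lemma norm2_sqr (R : realType) p (v : 'cV[R]_p) : norm2 v ^+ 2 = \sum_i v i 0 ^+ 2.
Proof. by rewrite sqr_sqrtr//; apply: sumr_ge0 => i _; exact: sqr_ge0. Qed.

Section MeanOperator.
Context {R : realType} {T : Type}.

(** The properties of an expectation used by the covariance algebra, on a domain [L] of
admissible variables.  They hold for the mean over a sample and for the expectation
of almost surely bounded variables, so each identity is proved once for both. *)
Record mean_operator (E : (T -> R) -> R) (L : set (T -> R)) : Prop := MeanOperator {
  mean_dom_cst : forall c, L (fun=> c);
  mean_cst : forall c, E (fun=> c) = c;
  mean_domD : forall f g, L f -> L g -> L (fun t => f t + g t);
  meanD : forall f g, L f -> L g -> E (fun t => f t + g t) = E f + E g;
  mean_domM : forall f g, L f -> L g -> L (fun t => f t * g t);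
  meanZ : forall c f, L f -> E (fun t => c * f t) = c * E f;
  mean_ge0 : forall f, L f -> (forall t, 0 <= f t) -> 0 <= E f }.

Variables (E : (T -> R) -> R) (L : set (T -> R)).
Hypothesis EL : mean_operator E L.

Lemma mean_domZ c f : L f -> L (fun t => c * f t).
Proof. by move=> Lf; apply: (mean_domM EL) => //; exact: (mean_dom_cst EL). Qed.

Lemma mean_domB f g : L f -> L g -> L (fun t => f t - g t).
Proof.
move=> Lf Lg; have := mean_domD EL Lf (mean_domZ (-1) Lg).
by under [X in L X -> _]eq_fun do rewrite mulN1r.
Qed.

Lemma meanB f g : L f -> L g -> E (fun t => f t - g t) = E f - E g.
Proof.
move=> Lf Lg; have := meanD EL Lf (mean_domZ (-1) Lg).
rewrite (meanZ EL)// mulN1r => <-.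
by congr E; apply/funext => t; rewrite mulN1r.
Qed.

Lemma mean_dom_sum (I : Type) (r : seq I) (F : I -> T -> R) :
  (forall i, L (F i)) -> L (fun t => \sum_(i <- r) F i t).
Proof.
move=> LF; elim: r => [|i r IHr].
  by under eq_fun do rewrite big_nil; exact: (mean_dom_cst EL).
by under eq_fun do rewrite big_cons; exact: (mean_domD EL).
Qed.

Lemma mean_sum (I : Type) (r : seq I) (F : I -> T -> R) :
  (forall i, L (F i)) ->
  E (fun t => \sum_(i <- r) F i t) = \sum_(i <- r) E (F i).
Proof.
move=> LF; elim: r => [|i r IHr].
  by rewrite big_nil -[RHS](mean_cst EL); congr E; apply/funext => t; rewrite big_nil.
rewrite big_cons -IHr -(meanD EL)//; last exact: mean_dom_sum.
by congr E; apply/funext => t; rewrite big_cons.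
Qed.

Lemma covmxE d (Z : T -> 'cV[R]_d) a b :
  covmx E Z a b = E (fun t => (Z t a 0 - E (fun t => Z t a 0)) *
                              (Z t b 0 - E (fun t => Z t b 0))).
Proof.
rewrite mxE; congr E; apply/funext => t.
by rewrite mxE big_ord1 !mxE.
Qed.

Section Covariance.
Variables (d : nat) (Z : T -> 'cV[R]_d).
Hypothesis LZ : forall a, L (fun t => Z t a 0).

Let centered a t := Z t a 0 - E (fun t => Z t a 0).

Let L_centered a : L (centered a).
Proof. by apply: mean_domB => //; exact: (mean_dom_cst EL). Qed.

(** A covariance may be computed after recentering at any constant [mu].  Recentering the
empirical covariance at the true mean expresses it by empirical means of fixed
functions. *)
Lemma covmx_shift (mu : 'cV[R]_d) a b :
  covmx E Z a b = E (fun t => (Z t a 0 - mu a 0) * (Z t b 0 - mu b 0)) -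
    E (fun t => Z t a 0 - mu a 0) * E (fun t => Z t b 0 - mu b 0).
Proof.
have Lc c : L (fun=> c) := mean_dom_cst EL c.
rewrite covmxE !meanB//.
set ma := E (fun t => Z t a 0); set mb := E (fun t => Z t b 0).
have -> : (fun t => (Z t a 0 - ma) * (Z t b 0 - mb)) =
    (fun t => (Z t a 0 - mu a 0) * (Z t b 0 - mu b 0) +
              ((mu a 0 - ma) * (Z t b 0 - mu b 0) +
               ((mu b 0 - mb) * (Z t a 0 - mu a 0) +
                (mu a 0 - ma) * (mu b 0 - mb)))).
  by apply/funext => t; ring.
have La : L (fun t => Z t a 0 - mu a 0) by exact: mean_domB.
have Lb : L (fun t => Z t b 0 - mu b 0) by exact: mean_domB.
have D1 : L (fun t => (mu b 0 - mb) * (Z t a 0 - mu a 0)) by exact: mean_domZ.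
have D2 : L (fun t => (mu a 0 - ma) * (Z t b 0 - mu b 0)) by exact: mean_domZ.
have D3 := mean_domM EL La Lb.
have D4 := mean_domD EL D1 (Lc ((mu a 0 - ma) * (mu b 0 - mb))).
rewrite (meanD EL)//; last exact: (mean_domD EL).
rewrite (meanD EL)// (meanD EL)// !(meanZ EL)// (mean_cst EL) !meanB// !(mean_cst EL).
rewrite -/ma -/mb; ring.
Qed.

Lemma covmx_sym : (covmx E Z)^T = covmx E Z.
Proof.
apply/matrixP => a b; rewrite mxE !covmxE; congr E; apply/funext => t.
by rewrite mulrC.
Qed.

(** This is at once the source of positivity of the covariance and of the expression of
the objective as a quadratic form. *)
Lemma covmx_form m (B : 'M[R]_(m, d)) :
  \tr (B *m covmx E Z *m B^T) =
  E (fun t => norm2 (B *m (Z t - expect_mx E Z)) ^+ 2).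
Proof.
have -> : (fun t => norm2 (B *m (Z t - expect_mx E Z)) ^+ 2) =
    (fun t => \sum_i \sum_a \sum_b B i a * B i b * (centered a t * centered b t)).
  apply/funext => t; rewrite norm2_sqr; apply: eq_bigr => i _.
  rewrite mxE expr2 big_distrlr/=; apply: eq_bigr => a _; apply: eq_bigr => b _.
  by rewrite !mxE mulrACA.
have L3 i a b : L (fun t => B i a * B i b * (centered a t * centered b t)).
  by apply: mean_domZ; exact: (mean_domM EL).
have L2 i a := mean_dom_sum (index_enum _) (L3 i a).
rewrite mean_sum; last by move=> i; exact: mean_dom_sum.
apply: eq_bigr => i _; rewrite mean_sum// mxE.
under eq_bigr do rewrite !mxE mulr_suml.
rewrite exchange_big/=; apply: eq_bigr => a _; rewrite mean_sum//.
apply: eq_bigr => b _; rewrite (meanZ EL) ?covmxE; last exact: (mean_domM EL).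
by rewrite mulrAC.
Qed.

Lemma covmx_form_ge0 : form_ge (covmx E Z) 0.
Proof.
split=> [|m B]; first exact: covmx_sym.
rewrite mul0r covmx_form; apply: (mean_ge0 EL) => [|t]; last exact: sqr_ge0.
under eq_fun do rewrite norm2_sqr; apply: mean_dom_sum => i.
under eq_fun do rewrite expr2 mxE.
suff Ls : L (fun t => \sum_j B i j * (Z t - expect_mx E Z) j 0) by exact: (mean_domM EL).
apply: mean_dom_sum => j; apply: mean_domZ.
by under eq_fun do rewrite !mxE; exact: L_centered.
Qed.

End Covariance.

Section Pair.
Variables (k d1 d2 : nat) (X : T -> 'cV[R]_d1 * 'cV[R]_d2).

Definition stacked t : 'cV[R]_(d1 + d2) := col_mx (X t).1 (X t).2.

Lemma covmx_stacked_ul : ulsubmx (covmx E stacked) = covmx E (comp1 X).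
Proof.
apply/matrixP => i j; rewrite mxE mxE !covmxE; congr E; apply/funext => t.
rewrite !col_mxEu /stacked.
by under eq_fun do rewrite col_mxEu; under [in X in _ * X]eq_fun do rewrite col_mxEu.
Qed.

Lemma covmx_stacked_dr : drsubmx (covmx E stacked) = covmx E (comp2 X).
Proof.
apply/matrixP => i j; rewrite mxE mxE !covmxE; congr E; apply/funext => t.
rewrite !col_mxEd /stacked.
by under eq_fun do rewrite col_mxEd; under [in X in _ * X]eq_fun do rewrite col_mxEd.
Qed.

Lemma feasible_stacked :
  feasible (k := k) E X = pair_feasible (covmx E stacked).
Proof.
by rewrite /feasible /pair_feasible /orthorows covmx_stacked_ul covmx_stacked_dr.
Qed.

Lemma expect_mx_stacked :
  expect_mx E stacked = col_mx (expect_mx E (comp1 X)) (expect_mx E (comp2 X)).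
Proof.
apply/matrixP => i j; rewrite mxE.
case: (split_ordP i) => l ->; rewrite ?col_mxEu ?col_mxEd mxE; congr E.
  by apply/funext => t; rewrite col_mxEu.
by apply/funext => t; rewrite col_mxEd.
Qed.

Lemma objective_stacked : (forall a, L (fun t => stacked t a 0)) ->
  objective (k := k) E X = pair_objective (covmx E stacked).
Proof.
move=> LX; apply/funext => A; rewrite /pair_objective covmx_form//.
congr E; apply/funext => t; rewrite expect_mx_stacked opp_col_mx add_col_mx.
by rewrite mul_row_col mulNmx.
Qed.

End Pair.
End MeanOperator.

(** * Expectation of almost surely bounded variables *)

Section Expectation.
Context {R : realType} {d : measure_display} {T : measurableType d}.
Variable P : probability T R.

(** Boundedness is only almost sure, as in the hypothesis on [X]; this class is stable
under products and contained in the integrable functions. *)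
Definition ae_bounded : set (T -> R) :=
  [set f : T -> R | measurable_fun setT f /\ exists b, {ae P, forall t, `|f t| <= b}].

Lemma ae_bounded_integrable f : ae_bounded f -> P.-integrable setT (EFin \o f).
Proof.
move=> [mf [b fb]]; apply/integrableP; split; first exact/measurable_EFinP.
apply: (@le_lt_trans _ _ (\int[P]_t (`|b|)%:E)%E); last first.
  by have := expectation_cst P `|b|; rewrite unlock => ->; exact: ltry.
apply: ae_ge0_le_integral => //.
- by apply: measurableT_comp => //; exact/measurable_EFinP.
- apply: filterS fb => t /= ftb _; rewrite lee_fin.
  exact: le_trans (ler_norm _).
Qed.

Lemma ae_bounded_Lfun f : ae_bounded f -> f \in Lfun P 1.
Proof. by move=> bf; apply/Lfun1_integrable; exact: ae_bounded_integrable. Qed.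

Lemma expect_fineK f : ae_bounded f -> (expect P f)%:E = 'E_P[f]%E.
Proof. by move=> bf; rewrite fineK// expectation_fin_num// ae_bounded_Lfun. Qed.

Lemma expect_mean_operator : mean_operator (expect P) ae_bounded.
Proof.
split.
- move=> c; split; first exact: measurable_cst.
  by exists `|c|; exact: aeW.
- by move=> c; rewrite /expect (expectation_cst P c).
- move=> f g [mf [b fb]] [mg [c gc]]; split; first exact: measurable_funD.
  exists (b + c); apply: filterS2 fb gc => t ftb gtc.
  by apply: le_trans (ler_normD _ _) _; exact: lerD.
- move=> f g bf bg; rewrite /expect (@expectationD _ _ _ P f g) ?ae_bounded_Lfun//.
  by rewrite fineD// expectation_fin_num// ae_bounded_Lfun.
- move=> f g [mf [b fb]] [mg [c gc]]; split; first exact: measurable_funM.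
  exists (b * c); apply: filterS2 fb gc => t ftb gtc.
  by rewrite normrM; exact: ler_pM.
- move=> c f bf; rewrite /expect.
  have := @expectationZl _ _ _ P f c (ae_bounded_Lfun bf) => /(congr1 fine).
  rewrite -(expect_fineK bf) -EFinM/= => <-.
  by congr (fine 'E_P[_]); apply/funext => t /=; rewrite mulrC.
- by move=> f bf f0; rewrite /expect fine_ge0// expectation_ge0.
Qed.

Lemma expect_le_ae f b : ae_bounded f -> (forall t, 0 <= f t) -> 0 <= b ->
  {ae P, forall t, f t <= b} -> expect P f <= b.
Proof.
move=> bf f0 b0 fb; rewrite -lee_fin expect_fineK// -(expectation_cst P b).
by apply: expectation_le => //; case: bf.
Qed.

Lemma markov_expect f a p : ae_bounded f -> (forall t, 0 <= f t) -> 0 < a ->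
  expect P f <= p * a -> ((1 - p)%:E <= P [set t | f t < a]%R)%E.
Proof.
move=> bf f0 a0 fpa.
have mf : measurable_fun setT f by case: bf.
pose F : {mfun T >-> R} := HB.pack f (isMeasurableFun.Build _ _ _ _ _ mf).
have := markov (P := P) F a0 (@measurable_id _ R setT) (fun r => id) (fun x y _ _ => id).
have -> : id \o (fun x : R => `|x|) \o F = f.
  by apply/funext => t /=; rewrite ger0_norm.
have -> : [set t | (a%:E <= `|(F t)%:E|)%E] = ~` [set t | f t < a].
  apply/seteqP; split=> t /=; rewrite lee_fin ger0_norm//.
    by move=> /le_gtF ->.
  by move=> /negP; rewrite -leNgt.
have mlt : measurable [set t | f t < a].
  by have := mf measurableT _ (measurable_itv `]-oo, a[); rewrite setTI set_itvE.
rewrite probability_setC// -expect_fineK// -[P _]fineK ?fin_num_measure//.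
rewrite -EFinB -EFinM !lee_fin => Pa.
have : a * (1 - fine (P [set t | f t < a])) <= p * a by exact: le_trans Pa fpa.
by rewrite mulrC ler_pM2r// => ?; lra.
Qed.

(** Independence identifies the law of [(U, V)] with the product of the laws, and Fubini's
theorem factors the integral. *)
Lemma expectM_indep (U V : T -> R) : ae_bounded U -> ae_bounded V ->
  (forall A B, measurable A -> measurable B ->
    P (U @^-1` A `&` V @^-1` B) = P (U @^-1` A) * P (V @^-1` B))%E ->
  expect P (fun t => U t * V t) = expect P U * expect P V.
Proof.
move=> bU bV UV.
have bUV := mean_domM expect_mean_operator bU bV.
have mU : measurable_fun setT U by case: bU.
have mV : measurable_fun setT V by case: bV.
have mUV := measurable_fun_pair mU mV.
pose U' : {mfun T >-> R} := HB.pack U (isMeasurableFun.Build _ _ _ _ _ mU).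
pose V' : {mfun T >-> R} := HB.pack V (isMeasurableFun.Build _ _ _ _ _ mV).
pose W : {mfun T >-> (R * R)%type} :=
  HB.pack (fun t => (U t, V t)) (isMeasurableFun.Build _ _ _ _ _ mUV).
pose h (z : R * R) := (z.1 * z.2)%:E.
have mh : measurable_fun setT h.
  apply/measurable_EFinP; apply: measurable_funM; first exact: measurable_fst.
  exact: measurable_snd.
have prodE A : measurable A -> (distribution P U' \x distribution P V')%E A = distribution P W A.
  apply: product_measure_unique => B C mB mC.
  by rewrite /distribution/= /pushforward/= -UV.
have hW : (distribution P W).-integrable setT h.
  by apply: integrable_pushforward => //; exact: ae_bounded_integrable.
have hUV : (distribution P U' \x distribution P V')%E.-integrable setT h.
  have /integrableP[_ hlty] := hW; apply/integrableP; split=> //.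
  by rewrite (eq_measure_integral (distribution P W))// => A mA _; exact: prodE.
have intE (Z : {mfun T >-> R}) : ae_bounded Z ->
    (\int[distribution P Z]_x x%:E)%E = (expect P Z)%:E.
  move=> bZ; rewrite expect_fineK// unlock.
  by rewrite integral_distribution//; exact: ae_bounded_integrable.
apply: EFin_inj; rewrite expect_fineK// unlock.
transitivity (\int[distribution P W]_z h z)%E.
  by rewrite integral_distribution//; exact: ae_bounded_integrable.
transitivity (\int[(distribution P U' \x distribution P V')%E]_z h z)%E.
  by apply: eq_measure_integral => A mA _; exact: esym (prodE A mA).
rewrite -integral12_prod_meas1//.
transitivity (\int[distribution P U']_x (x%:E * (expect P V)%:E))%E.
  apply: eq_integral => x _; rewrite /fubini_F/= -(intE V')// -integralZl//.
  by apply: integrable_pushforward => //; exact: ae_bounded_integrable.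
rewrite integralZr//; first by rewrite (intE U').
by apply: integrable_pushforward => //; exact: ae_bounded_integrable.
Qed.

End Expectation.

(** * Second moments of empirical means *)

Section UniformMean.
Context {R : realType} {n : nat}.

Lemma expect_unif_mean_operator : (0 < n)%N -> mean_operator (@expect_unif R n) setT.
Proof.
move=> n0; have nn0 : n%:R != 0 :> R by rewrite pnatr_eq0 -lt0n.
split=> //.
- by move=> c; rewrite /expect_unif sumr_const card_ord -[c *+ n]mulr_natl mulKf.
- by move=> f g _ _; rewrite /expect_unif big_split mulrDr.
- by move=> c f _; rewrite /expect_unif -mulr_sumr mulrCA.
- move=> f _ f0; rewrite /expect_unif mulr_ge0 ?invr_ge0//.
  by apply: sumr_ge0 => i _; exact: f0.
Qed.

End UniformMean.

Section Sampling.
Context {R : realType} {d1 d2 : nat}.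
Context {dT : measure_display} {T : measurableType dT} {P : probability T R}.
Context {dT' : measure_display} {T' : measurableType dT'} {P' : probability T' R}.
Variable X : {RV P >-> rvec R d1 d2}.

Lemma continuous_rvec_measurable (phi : 'cV[R]_d1 * 'cV[R]_d2 -> R) :
  continuous phi -> measurable_fun setT (phi : rvec R d1 d2 -> R).
Proof.
move=> /continuousP cphi; apply: (measurability _ (RGenOpens.measurableE R)).
move=> _ [_ [a [b ->] <-]]; rewrite setTI.
by apply: sub_sigma_algebra; exact/cphi/interval_open.
Qed.

Section SameLaw.
Variables (Y : {RV P' >-> rvec R d1 d2}).
Hypothesis XY : same_law X Y.

Lemma same_law_ae (f : rvec R d1 d2 -> R) b : measurable_fun setT f ->
  {ae P, forall t, `|f (X t)| <= b} -> {ae P', forall t, `|f (Y t)| <= b}.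
Proof.
move=> mf fXb.
have mN : measurable [set x | ~ (`|f x| <= b)].
  have mnf : measurable_fun setT (fun x => `|f x|) by exact: measurableT_comp.
  have := mnf measurableT _ (measurable_itv `]b, +oo[); rewrite setTI set_itvE.
  congr measurable; apply/seteqP; split=> x /=; last by move=> /negP; rewrite -ltNge.
  by rewrite ltNge => /negP.
have mX : measurable (X @^-1` [set x | ~ (`|f x| <= b)]).
  by rewrite -[X in measurable X]setTI; exact: measurable_funP.
have mY : measurable (Y @^-1` [set x | ~ (`|f x| <= b)]).
  by rewrite -[X in measurable X]setTI; exact: measurable_funP.
have X0 : P.-negligible (X @^-1` [set x | ~ (`|f x| <= b)]) by exact: fXb.
suff : P'.-negligible (Y @^-1` [set x | ~ (`|f x| <= b)]) by [].
apply/(negligibleP P' mY).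
transitivity (distribution P' Y [set x | ~ (`|f x| <= b)]); first by [].
by rewrite -XY//; exact/(negligibleP P mX).
Qed.

Lemma same_law_ae_bounded (f : rvec R d1 d2 -> R) : measurable_fun setT f ->
  ae_bounded P (f \o X) -> ae_bounded P' (f \o Y).
Proof.
move=> mf [_ [b fb]]; split; first exact: measurableT_comp.
by exists b; exact: same_law_ae fb.
Qed.

Lemma same_law_expect (f : rvec R d1 d2 -> R) : measurable_fun setT f ->
  ae_bounded P (f \o X) -> expect P' (f \o Y) = expect P (f \o X).
Proof.
move=> mf bX; have bY := same_law_ae_bounded mf bX.
rewrite /expect unlock; congr fine.
have mEf : measurable_fun setT (EFin \o f) by exact/measurable_EFinP.
transitivity (\int[distribution P' Y]_x (f x)%:E)%E.
  by rewrite (@integral_distribution _ _ _ _ _ P' Y (EFin \o f))//; exact: ae_bounded_integrable.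
transitivity (\int[distribution P X]_x (f x)%:E)%E.
  by apply: eq_measure_integral => A mA _; exact: esym (XY mA).
by rewrite (@integral_distribution _ _ _ _ _ P X (EFin \o f))//; exact: ae_bounded_integrable.
Qed.

End SameLaw.

Section Copies.
Variables (n : nat) (Y : 'I_n -> {RV P' >-> rvec R d1 d2}).
Hypothesis XY : independent_copies X Y.

(** Independence of the pair [(Y i, Y j)] is the case of the product rule in which all
other events are the whole space. *)
Lemma copies_expectM (f g : rvec R d1 d2 -> R) i j :
  measurable_fun setT f -> measurable_fun setT g ->
  ae_bounded P (f \o X) -> ae_bounded P (g \o X) -> i != j ->
  expect P' (fun w => f (Y i w) * g (Y j w)) =
    expect P (f \o X) * expect P (g \o X).
Proof.
move=> mf mg bf bg ij; have [indep law] := XY.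
rewrite -(same_law_expect (law i))// -(same_law_expect (law j))//.
apply: expectM_indep.
- exact: same_law_ae_bounded (law i) _ mf bf.
- exact: same_law_ae_bounded (law j) _ mg bg.
move=> A B mA mB.
have mfA : measurable (f @^-1` A) by rewrite -[X in measurable X]setTI; exact: mf.
have mgB : measurable (g @^-1` B) by rewrite -[X in measurable X]setTI; exact: mg.
(* The events other than the [i]-th and the [j]-th are trivial. *)
pose C l := if l == i then f @^-1` A else if l == j then g @^-1` B else setT.
have Ci : C i = f @^-1` A by rewrite /C eqxx.
have Cj : C j = g @^-1` B by rewrite /C eq_sym (negbTE ij) eqxx.
have := indep C; rewrite (bigD1 i)//= (bigD1 j) 1?eq_sym//= Ci Cj.
rewrite big1 ?mule1 => [<-|l /andP[li lj]].
- congr (P' _); apply/seteqP; split=> [w [fA gB] l _|w /= Cw].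
    by rewrite /C/=; case: eqP => [->|_] //; case: eqP => [->|_].
  by split; [have := Cw i I; rewrite Ci|have := Cw j I; rewrite Cj].
- by move=> l; rewrite /C; case: eqP => // _; case: eqP.
- by rewrite /C (negbTE li) (negbTE lj) preimage_setT probability_setT.
Qed.

Hypothesis n_gt0 : (0 < n)%N.

Let L' := ae_bounded P'.
Let EL := expect_mean_operator P.
Let EL' := expect_mean_operator P'.

(** The square of the sum of the centered variables [u (Y j)] expands into [n^2] terms,
whose off-diagonal ones have expectation zero by independence.  Each of the [n]
diagonal ones is a variance, hence at most the second moment of [g X]. *)
Lemma expect_sqr_dev_le (g : rvec R d1 d2 -> R) :
  measurable_fun setT g -> ae_bounded P (g \o X) ->
  let dev w := expect_unif (fun j => g (Y j w)) - expect P (g \o X) in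
  L' dev /\
  expect P' (fun w => dev w ^+ 2) <= n%:R^-1 * expect P (fun t => g (X t) ^+ 2).
Proof.
move=> mg bg dev; set c := expect P (g \o X) in dev *.
have law j := XY.2 j.
pose u (x : rvec R d1 d2) := g x - c.
have mu : measurable_fun setT u by exact: measurable_funB.
have bu : ae_bounded P (u \o X) by apply: (mean_domB EL) => //; exact: (mean_dom_cst EL).
have Eu : expect P (u \o X) = 0.
  rewrite (meanB EL bg (mean_dom_cst EL c)) (mean_cst EL); exact: subrr.
have nn0 : n%:R != 0 :> R by rewrite pnatr_eq0 -lt0n.
have devE w : dev w = n%:R^-1 * \sum_j u (Y j w).
  by rewrite /u sumrB sumr_const card_ord -[c *+ n]mulr_natl mulrBr mulKf.
have bY j : L' (fun w => u (Y j w)) := same_law_ae_bounded (law j) mu bu.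
have bdev : L' dev.
  rewrite (funext devE); apply: (mean_domZ EL').
  exact: (mean_dom_sum EL' (index_enum _) bY).
split=> //.
have bYY i j : L' (fun w => u (Y i w) * u (Y j w)) by exact: (mean_domM EL' (bY i) (bY j)).
have dev2E : (fun w => dev w ^+ 2) =
    (fun w => n%:R^-1 ^+ 2 * \sum_i \sum_j u (Y i w) * u (Y j w)).
  by apply/funext => w; rewrite devE exprMn [X in _ * X = _]expr2 big_distrlr.
have bSS i := mean_dom_sum EL' (index_enum _) (bYY i).
have bg2 : ae_bounded P (fun t => g (X t) ^+ 2).
  by under eq_fun do rewrite expr2; exact: (mean_domM EL).
have Eu2 : expect P (fun t => u (X t) * u (X t)) <= expect P (fun t => g (X t) ^+ 2).
  rewrite -subr_ge0 -(meanB EL) //; last exact: (mean_domM EL).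
  have -> : (fun t => g (X t) ^+ 2 - u (X t) * u (X t)) =
      (fun t => 2 * c * u (X t) + c ^+ 2).
    by apply/funext => t; rewrite /u; ring.
  rewrite (meanD EL (mean_domZ EL (2 * c) bu) (mean_dom_cst EL (c ^+ 2))).
  by rewrite (meanZ EL (2 * c) bu) Eu mulr0 add0r (mean_cst EL) sqr_ge0.
rewrite dev2E (meanZ EL'); last exact: (mean_dom_sum EL' (index_enum _) bSS).
rewrite (mean_sum EL' (index_enum _) bSS).
have Ei i : expect P' (fun w => \sum_j u (Y i w) * u (Y j w)) <=
    expect P (fun t => g (X t) ^+ 2).
  rewrite (mean_sum EL' (index_enum _) (bYY i)) (bigD1 i)//= big1 ?addr0 => [|j ji].
    rewrite (@same_law_expect _ (law i) (fun x => u x * u x))//.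
      exact: measurable_funM.
    exact: (mean_domM EL).
  by rewrite copies_expectM// 1?eq_sym// Eu mulr0.
rewrite expr2 -mulrA ler_wpM2l ?invr_ge0// ler_pdivrMl ?ltr0n//.
rewrite mulr_natl -[X in _ <= _ *+ X](card_ord n) -sumr_const.
exact: ler_sum.
Qed.

Lemma sum_sqr_dev_small (I : finType) (g : I -> rvec R d1 d2 -> R) b p :
  (forall a, measurable_fun setT (g a)) ->
  (forall a, ae_bounded P (g a \o X)) ->
  {ae P, forall t, \sum_a g a (X t) ^+ 2 <= b} -> 0 < b -> 0 < p ->
  let dev w := \sum_a (expect_unif (fun j => g a (Y j w)) - expect P (g a \o X)) ^+ 2 in
  measurable [set w | dev w < b / (n%:R * p)] /\
  ((1 - p)%:E <= P' [set w | dev w < b / (n%:R * p)]%R)%E.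
Proof.
move=> mg bg gb b0 p0 dev.
have bdev a := (expect_sqr_dev_le (mg a) (bg a)).1.
have bdev2 a : L' (fun w => (expect_unif (fun j => g a (Y j w)) - expect P (g a \o X)) ^+ 2).
  by under eq_fun do rewrite expr2; exact: (mean_domM EL' (bdev a) (bdev a)).
have bsum : L' dev := mean_dom_sum EL' (index_enum _) bdev2.
have dev0 w : 0 <= dev w by apply: sumr_ge0 => a _; exact: sqr_ge0.
have bg2 a : ae_bounded P (fun t => g a (X t) ^+ 2).
  by under eq_fun do rewrite expr2; exact: (mean_domM EL (bg a) (bg a)).
have n0 : 0 < n%:R :> R by rewrite ltr0n.
split.
  have [mdev _] := bsum.
  by have := mdev measurableT _ (measurable_itv `]-oo, (b / (n%:R * p))[); rewrite setTI set_itvE.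
apply: markov_expect => //; first by rewrite divr_gt0// mulr_gt0.
rewrite (mean_sum EL' (index_enum _) bdev2).
apply: (@le_trans _ _ (n%:R^-1 * expect P (fun t => \sum_a g a (X t) ^+ 2))).
  rewrite (mean_sum EL (index_enum _) bg2) mulr_sumr; apply: ler_sum => a _.
  exact: (expect_sqr_dev_le (mg a) (bg a)).2.
have -> : p * (b / (n%:R * p)) = n%:R^-1 * b by field; rewrite !gt_eqF.
rewrite ler_pM2l ?invr_gt0//; apply: expect_le_ae => //.
- exact: (mean_dom_sum EL (index_enum _) bg2).
- by move=> t; apply: sumr_ge0 => a _; exact: sqr_ge0.
- exact: ltW.
Qed.

End Copies.
End Sampling.

(** * Concentration of the empirical covariance *)

Section EmpiricalCovariance.
Context {R : realType}.

Lemma sum_option (I : finType) (F : option I -> R) :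
  \sum_o F o = F None + \sum_i F (Some i).
Proof.
rewrite (bigD1 None)//= (reindex_omap Some id) => [|[i|]]//=.
by congr (_ + _); apply: eq_bigl => i; rewrite eqxx.
Qed.

Section Coordinates.
Variables (d1 d2 : nat) (mu : 'cV[R]_d1 * 'cV[R]_d2) (beta : R).
Let d := (d1 + d2)%N.

(** The constant [beta] is adjoined to the centered coordinates so that the products of
two augmented coordinates include the multiples [beta * (x_a - mu_a)]: one family of
functions controls both the empirical second moments and the empirical mean. *)
Definition augmented (o : option 'I_d) (x : rvec R d1 d2) : R :=
  if o is Some a then stacked id x a 0 - col_mx mu.1 mu.2 a 0 else beta.

Lemma measurable_augmented o : measurable_fun setT (augmented o).
Proof.
case: o => [a|]; last exact: measurable_cst.
apply: measurable_funB; last exact: measurable_cst.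
apply: (@continuous_rvec_measurable R d1 d2 (fun x => stacked id x a 0)).
case: (split_ordP a) => i ->.
  under eq_fun do rewrite col_mxEu.
  by move=> x; exact: (continuous_comp cvg_fst (@coord_continuous R _ _ i 0 _)).
under eq_fun do rewrite col_mxEd.
by move=> x; exact: (continuous_comp cvg_snd (@coord_continuous R _ _ i 0 _)).
Qed.

(** One [beta ^+ 2] for the adjoined constant and one for each of the two components. *)
Lemma sum_augmented_sqr (x : rvec R d1 d2) : 0 <= beta ->
  norm2inf ((x : 'cV[R]_d1 * 'cV[R]_d2) - mu) <= beta ->
  \sum_o augmented o x ^+ 2 <= 3 * beta ^+ 2.
Proof.
move=> b0; rewrite /norm2inf ge_max/= => /andP[x1 x2].
rewrite sum_option/= big_split_ord/=.
have sqr_le p (v : 'cV[R]_p) : norm2 v <= beta -> \sum_i v i 0 ^+ 2 <= beta ^+ 2.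
  move=> vb; rewrite -norm2_sqr ler_pXn2r// nnegrE; exact: sqrtr_ge0.
have h1 := sqr_le _ _ x1; have h2 := sqr_le _ _ x2.
have -> : 3 * beta ^+ 2 = beta ^+ 2 + (beta ^+ 2 + beta ^+ 2) by ring.
rewrite lerD2l; apply: lerD.
  apply: le_trans h1; apply: ler_sum => i _.
  by rewrite /stacked !col_mxEu !mxE.
apply: le_trans h2; apply: ler_sum => i _.
by rewrite /stacked !col_mxEd !mxE.
Qed.

End Coordinates.

Section Concentration.
Variables (d1 d2 : nat).
Context {dT : measure_display} {T : measurableType dT} {P : probability T R}.
Variables (X : {RV P >-> rvec R d1 d2}) (beta : R).
Hypothesis beta_gt0 : 0 < beta.
Hypothesis X_bounded : {ae P, forall t,
  norm2inf ((X t : 'cV[R]_d1 * 'cV[R]_d2) - mean_pair (expect P) X) <= beta}.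
Let d := (d1 + d2)%N.
Let z := augmented (mean_pair (expect P) X) beta.
Let EP := expect_mean_operator P.
Let mu := expect_mx (expect P) (stacked X).

Lemma ae_bounded_augmented o : ae_bounded P (z o \o X).
Proof.
split; first by apply: measurableT_comp => //; exact: measurable_augmented.
exists (1 + 3 * beta ^+ 2); apply: filterS X_bounded => t Xt.
have := sum_augmented_sqr (ltW beta_gt0) Xt; rewrite (bigD1 o)//= => zt.
have z2 : z o (X t) ^+ 2 <= 3 * beta ^+ 2.
  apply: le_trans zt; rewrite lerDl; apply: sumr_ge0 => a _; exact: sqr_ge0.
rewrite -real_normK ?num_real// in z2.
by move: z2 (normr_ge0 (z o (X t))); move: `|_| => y; nra.
Qed.

Lemma augmentedE (x : rvec R d1 d2) a : z (Some a) x = stacked id x a 0 - mu a 0.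
Proof. by rewrite /z /= /mu expect_mx_stacked. Qed.

Lemma ae_bounded_stacked a : ae_bounded P (fun t => stacked X t a 0).
Proof.
have -> : (fun t => stacked X t a 0) = (fun t => (z (Some a) \o X) t + mu a 0).
  by apply/funext => t; rewrite [(z (Some a) \o X) t](augmentedE (X t) a) subrK.
exact: (mean_domD EP (ae_bounded_augmented (Some a)) (mean_dom_cst EP (mu a 0))).
Qed.

Lemma expect_augmented a : expect P (z (Some a) \o X) = 0.
Proof.
have -> : z (Some a) \o X = (fun t => stacked X t a 0 - mu a 0).
  by apply/funext => t; exact: augmentedE.
rewrite (meanB EP (ae_bounded_stacked a) (mean_dom_cst EP _)) (mean_cst EP).
by rewrite /mu mxE subrr.
Qed.

(** With [form_ge] for the diagonal blocks, this bounds the dimension by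
[beta^2 / sigma^2]. *)
Lemma trace_covmx_le : \tr (covmx (expect P) (stacked X)) <= 2 * beta ^+ 2.
Proof.
have bz a := mean_domM EP (ae_bounded_augmented (Some a)) (ae_bounded_augmented (Some a)).
have -> : \tr (covmx (expect P) (stacked X)) =
    expect P (fun t => \sum_a (z (Some a) \o X) t * (z (Some a) \o X) t).
  rewrite (mean_sum EP (index_enum _) bz); apply: eq_bigr => a _.
  have mua : expect P (fun t => stacked X t a 0) = mu a 0 by rewrite mxE.
  rewrite covmxE mua; congr expect; apply/funext => t.
  exact: esym (congr2 *%R (augmentedE (X t) a) (augmentedE (X t) a)).
apply: expect_le_ae; first exact: (mean_dom_sum EP (index_enum _) bz).
- by move=> t; apply: sumr_ge0 => a _; rewrite -expr2 sqr_ge0.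
- by rewrite mulr_ge0// sqr_ge0.
apply: filterS X_bounded => t Xt.
have := sum_augmented_sqr (ltW beta_gt0) Xt; rewrite sum_option => zt.
have -> : \sum_a (z (Some a) \o X) t * (z (Some a) \o X) t =
    \sum_a z (Some a) (X t) ^+ 2 by apply: eq_bigr => a _; rewrite expr2.
have : beta ^+ 2 + \sum_a z (Some a) (X t) ^+ 2 <= 3 * beta ^+ 2 by exact: zt.
by move: (\sum_a _) => y; lra.
Qed.

Section Sample.
Context {dT' : measure_display} {T' : measurableType dT'} {P' : probability T' R}.
Variables (n : nat) (Y : 'I_n -> {RV P' >-> rvec R d1 d2}).
Hypothesis n_gt0 : (0 < n)%N.
Hypothesis XY : independent_copies X Y.

(** The error of the empirical covariance is [D - v v^T], with [D] the deviation of the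
empirical second moments and [v] the empirical mean of the centered coordinates.
The event bounds [|D|^2] and [beta^2 |v|^2] together by [a]. *)
Lemma covmx_concentration p : 0 < p ->
  exists G : set T', [/\ measurable G, ((1 - p)%:E <= P' G)%E &
    forall w, G w ->
      let a := 9 * beta ^+ 4 / (n%:R * p) in
      fnorm (covmx (@expect_unif R n) (stacked (fun j => Y j w)) -
             covmx (expect P) (stacked X)) <= Num.sqrt a + a / beta ^+ 2].
Proof.
move=> p0.
pose g (o : option 'I_d * option 'I_d) (x : rvec R d1 d2) := z o.1 x * z o.2 x.
have mg o : measurable_fun setT (g o).
  by apply: measurable_funM; exact: measurable_augmented.
have bg o : ae_bounded P (g o \o X).
  by apply: (mean_domM EP); exact: ae_bounded_augmented.
have gb : {ae P, forall t, \sum_o g o (X t) ^+ 2 <= 9 * beta ^+ 4}.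
  apply: filterS X_bounded => t Xt.
  have zt := sum_augmented_sqr (ltW beta_gt0) Xt.
  rewrite -(pair_bigA _ (fun o1 o2 => g (o1, o2) (X t) ^+ 2))/=.
  under eq_bigr do under eq_bigr do rewrite /g/= exprMn.
  rewrite -big_distrlr/=.
  have -> : 9 * beta ^+ 4 = (3 * beta ^+ 2) * (3 * beta ^+ 2) by ring.
  by apply: ler_pM => //; apply: sumr_ge0 => o _; exact: sqr_ge0.
have b0 : 0 < 9 * beta ^+ 4 by rewrite mulr_gt0// exprn_gt0.
have [mG PG] := sum_sqr_dev_small XY n_gt0 mg bg gb b0 p0.
eexists; split; [exact: mG|exact: PG|].
move=> w /= devw; set a := _ / _ in devw *.
have a0 : 0 < a by rewrite divr_gt0// mulr_gt0// ltr0n.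
pose dev o1 o2 := expect_unif (fun j => g (o1, o2) (Y j w)) - expect P (g (o1, o2) \o X).
have {}devw : \sum_o1 \sum_o2 dev o1 o2 ^+ 2 <= a.
  rewrite (pair_bigA _ (fun o1 o2 => dev o1 o2 ^+ 2)).
  by apply: le_trans (ltW devw); apply: ler_sum; case=> o1 o2 _.
have EU := @expect_unif_mean_operator R n n_gt0.
pose m c := expect_unif (fun j => z (Some c) (Y j w)).
have devN c : dev (Some c) None = beta * m c.
  rewrite /dev.
  have -> : g (Some c, None) \o X = (fun t => beta * (z (Some c) \o X) t).
    by apply/funext => t; rewrite mulrC.
  rewrite (meanZ EP beta (ae_bounded_augmented (Some c))) expect_augmented mulr0 subr0.
  rewrite -(meanZ EU beta (f := fun j => z (Some c) (Y j w)) I).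
  by congr expect_unif; apply/funext => j; rewrite mulrC.
pose D : 'M[R]_d := \matrix_(b, c) dev (Some b) (Some c).
pose v : 'cV[R]_d := \col_c m c.
have -> : covmx (@expect_unif R n) (stacked (fun j => Y j w)) -
    covmx (expect P) (stacked X) = D - v *m v^T.
  apply/matrixP => b c; rewrite [LHS]mxE [X in _ + X]mxE.
  rewrite (covmx_shift EU (fun=> I) mu) (covmx_shift EP ae_bounded_stacked mu).
  have Xc e : (fun t => stacked X t e 0 - mu e 0) = z (Some e) \o X.
    by apply/funext => t; exact: esym (augmentedE (X t) e).
  have Yc e : (fun j => stacked (fun j => Y j w) j e 0 - mu e 0) =
      (fun j => z (Some e) (Y j w)).
    by apply/funext => j; exact: esym (augmentedE (Y j w) e).
  have XXc : (fun t => (stacked X t b 0 - mu b 0) * (stacked X t c 0 - mu c 0)) =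
      g (Some b, Some c) \o X.
    by apply/funext => t; exact: esym (congr2 *%R (augmentedE _ _) (augmentedE _ _)).
  have YYc : (fun j => (stacked (fun j => Y j w) j b 0 - mu b 0) *
                       (stacked (fun j => Y j w) j c 0 - mu c 0)) =
      (fun j => g (Some b, Some c) (Y j w)).
    by apply/funext => j; exact: esym (congr2 *%R (augmentedE _ _) (augmentedE _ _)).
  rewrite XXc YYc !Xc !Yc !expect_augmented mulr0 subr0 addrAC.
  have -> : (D - v *m v^T) b c = dev (Some b) (Some c) - m b * m c.
    by rewrite !mxE big_ord1 !mxE.
  by [].
apply: le_trans (fnorm_triangle _ _) _; rewrite fnormN; apply: lerD.
  rewrite -(ler_pXn2r (n := 2))// ?nnegrE ?fnorm_ge0 ?sqrtr_ge0//.
  rewrite (@sqr_sqrtr _ a) ?(ltW a0)// fnorm_sqrE; apply: le_trans devw.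
  rewrite sum_option/= ler_wpDl//; first by apply: sumr_ge0 => ? _; exact: sqr_ge0.
  apply: ler_sum => b _; rewrite sum_option ler_wpDl ?sqr_ge0//.
  by apply: ler_sum => c _; rewrite mxE.
apply: le_trans (fnormM _ _) _; rewrite fnorm_tr -expr2 fnorm_sqrE.
rewrite ler_pdivlMr ?exprn_gt0// mulr_suml; apply: le_trans devw.
rewrite sum_option/= ler_wpDl//; first by apply: sumr_ge0 => ? _; exact: sqr_ge0.
apply: ler_sum => b _; rewrite sum_option devN big_ord1 mxE [X in _ <= X + _]exprMn.
rewrite [X in _ <= X + _]mulrC lerDl.
by apply: sumr_ge0 => ? _; exact: sqr_ge0.
Qed.

End Sample.
End Concentration.
End EmpiricalCovariance.

(** * Convergence of the empirical minimum *)

Theorem theorem2 (R : realType) (p : R) (p_gt0 : 0 < p) (p_le1 : p <= 1) :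
  exists C : R, 0 < C /\
  forall (d1 d2 k n : nat),
    (0 < d1)%N -> (0 < d2)%N -> (0 < k)%N -> (0 < n)%N ->
    (k <= minn d1 d2)%N ->
  forall (beta sigma : R), 0 < beta -> 0 < sigma ->
  forall (dT : measure_display) (T : measurableType dT) (P : probability T R)
         (X : {RV P >-> rvec R d1 d2}),
    {ae P, forall t,
      norm2inf ((X t : 'cV[R]_d1 * 'cV[R]_d2) - mean_pair (expect P) X)
        <= beta} ->
    sigma ^+ 2 <= Num.min (lambda_min (covmx (expect P) (comp1 X)))
                          (lambda_min (covmx (expect P) (comp2 X))) ->
  forall (dT' : measure_display) (T' : measurableType dT')
         (P' : probability T' R) (Y : 'I_n -> {RV P' >-> rvec R d1 d2}),
    independent_copies X Y ->
  forall eps : R, 0 < eps -> eps <= 1 ->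
    C * ((d1 + d2)%:R * (k%:R / eps ^+ 2) * ln (k%:R / eps ^+ 2)
         + (beta / (eps * sigma)) ^+ 4 * ln (d1 + d2)%:R) <= n%:R ->
  exists m : R,
    is_min (feasible (k := k) (expect P) X) (objective (expect P) X) m /\
  exists G : set T', measurable G /\ ((1 - p)%:E <= P' G)%E /\
    forall w : T', G w ->
    exists mhat : R,
      is_min (feasible (k := k) (@expect_unif R n) (fun j => Y j w))
             (objective (@expect_unif R n) (fun j => Y j w)) mhat /\
      `|mhat - m| <= eps * (beta ^+ 2 / sigma ^+ 2).
Proof.
have ln2 : 0 < ln 2 :> R by rewrite ln_gt0// ltr1n.
(* The factor [9 / p] comes from Markov's inequality and [60] is twice the [30] of the
   perturbation bound; [ln 2] bounds [ln (d1 + d2)] from below. *)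
exists (9 * 60 ^+ 2 / (p * ln 2)); split; first by rewrite divr_gt0// mulr_gt0// exprn_gt0.
move=> d1 d2 k n d1_gt0 d2_gt0 k_gt0 n_gt0 kd beta sigma beta0 sigma0.
move=> dT T P X X_bounded sigma_le dT' T' P' Y XY eps eps0 eps1 n_ge.
have EP := expect_mean_operator P.
have LX := ae_bounded_stacked beta0 X_bounded.
pose S := covmx (expect P) (stacked X).
have s0 : 0 < sigma ^+ 2 by rewrite exprn_gt0.
have S0 : form_ge S 0 := covmx_form_ge0 EP LX.
have S_ge : blocks_ge S (sigma ^+ 2).
  move: sigma_le; rewrite le_min => /andP[s1 s2].
  split=> //; apply: lambda_min_form_ge => //.
  - by rewrite trmx_ulsub S0.1.
  - by rewrite covmx_stacked_ul.
  - by rewrite trmx_drsub S0.1.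
  - by rewrite covmx_stacked_dr.
(* Twice [k] is at most [d1 + d2], and [(d1 + d2) sigma^2 <= \tr S <= 2 beta^2]. *)
have k_le : k%:R * sigma ^+ 2 <= beta ^+ 2.
  have trS := trace_covmx_le beta0 X_bounded; rewrite -/S in trS.
  have [_ S1 S2] := S_ge.
  have := S1.2 _ 1%:M; have := S2.2 _ 1%:M.
  rewrite !trmx1 !mulmx1 !mul1mx !mxtrace1 => t2 t1.
  rewrite -[S]submxK mxtrace_block in trS.
  move: kd; rewrite leq_min -!(ler_nat R) => /andP[k1 k2].
  have : sigma ^+ 2 * k%:R <= sigma ^+ 2 * d1%:R by rewrite ler_pM2l.
  have : sigma ^+ 2 * k%:R <= sigma ^+ 2 * d2%:R by rewrite ler_pM2l.
  by rewrite [k%:R * _]mulrC; lra.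
have sigma_beta : sigma ^+ 2 <= beta ^+ 2.
  by apply: le_trans k_le; rewrite ler_peMl ?ler1n ?(ltW s0).
have [m minm] := pair_min_exists kd s0 S_ge.
exists m; split.
  by rewrite feasible_stacked (objective_stacked EP k LX).
have [G [mG PG devG]] := covmx_concentration beta0 X_bounded n_gt0 XY p_gt0.
exists G; split=> //; split=> // w Gw.
pose S' := covmx (@expect_unif R n) (stacked (fun j => Y j w)).
have EU := @expect_unif_mean_operator R n n_gt0.
have S'0 : form_ge S' 0 by exact: (covmx_form_ge0 EU (fun=> I)).
have n0 : 0 < n%:R :> R by rewrite ltr0n.
have t8 : eps / 30 <= 8^-1 by lra.
have close : fnorm (S' - S) <= sigma ^+ 2 * (eps / 30).
  apply: le_trans (devG w Gw) _.
  (* Both terms of the concentration bound are at most half of [sigma ^+ 2 * (eps / 30)]. *)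
  set a := _ / _; pose e := eps * sigma ^+ 2 / 60.
  have e0 : 0 < e by rewrite divr_gt0// mulr_gt0.
  have a_le : a <= e ^+ 2.
    pose q := (beta / (eps * sigma)) ^+ 4.
    have q0 : 0 < q by rewrite exprn_gt0// divr_gt0// mulr_gt0.
    have np : 9 * 60 ^+ 2 * q <= n%:R * p.
      have k_eps : 1 <= k%:R / eps ^+ 2.
        rewrite ler_pdivlMr ?exprn_gt0// mul1r.
        by rewrite (@le_trans _ _ 1) ?ler1n// expr_le1// ltW.
      have first_ge0 : 0 <= (d1 + d2)%:R * (k%:R / eps ^+ 2) * ln (k%:R / eps ^+ 2).
        by rewrite mulr_ge0 ?ln_ge0// mulr_ge0// (le_trans _ k_eps).
      have ln_d : ln 2 <= ln (d1 + d2)%:R :> R.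
        have d2le : 2 <= (d1 + d2)%:R :> R by rewrite ler_nat -[2%N]/(1 + 1)%N leq_add.
        by rewrite ler_ln ?posrE ?(lt_le_trans _ d2le).
      have qln : q * ln 2 <= (d1 + d2)%:R * (k%:R / eps ^+ 2) * ln (k%:R / eps ^+ 2)
          + q * ln (d1 + d2)%:R.
        by rewrite ler_wpDl// ler_pM2l.
      have C0 : 0 <= 9 * 60 ^+ 2 / (p * ln 2).
        by rewrite divr_ge0// ?mulr_ge0 ?exprn_ge0 ?(ltW p_gt0) ?(ltW ln2).
      have := le_trans (ler_wpM2l C0 qln) n_ge.
      rewrite -(ler_pM2r p_gt0); apply: le_trans.
      by rewrite le_eqVlt; apply/orP; left; apply/eqP; field; rewrite !gt_eqF.
    (* [e ^+ 2 * (9 * 60 ^+ 2 * q)] equals [9 * beta ^+ 4 / eps ^+ 2], and [eps <= 1]. *)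
    rewrite /a ler_pdivrMr ?mulr_gt0//; apply: (@le_trans _ _ (e ^+ 2 * (9 * 60 ^+ 2 * q))).
      have -> : e ^+ 2 * (9 * 60 ^+ 2 * q) = 9 * beta ^+ 4 / eps ^+ 2.
        by rewrite /e /q; field; rewrite !gt_eqF.
      rewrite ler_pdivlMr ?exprn_gt0// ler_piMr ?expr_le1 ?(ltW eps0)//.
      by rewrite mulr_ge0// exprn_ge0// ltW.
    by rewrite ler_pM2l// exprn_gt0.
  have sqrta : Num.sqrt a <= e.
    by rewrite -(ger0_norm (ltW e0)) -sqrtr_sqr ler_sqrt// sqr_ge0.
  have abeta : a / beta ^+ 2 <= e.
    rewrite ler_pdivrMr ?exprn_gt0//; apply: le_trans a_le _.
    (* The second term is even quadratic in [e], and [e <= sigma ^+ 2 <= beta ^+ 2]. *)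
    rewrite expr2 ler_pM2l//; apply: le_trans sigma_beta; rewrite /e.
    nra.
  by rewrite /e in sqrta abeta; lra.
have [m' minm' m'm] := pair_min_close k_gt0 kd s0 t8 S_ge S'0 close minm.
exists m'; split.
  by rewrite feasible_stacked (objective_stacked EU k (fun=> I)).
apply: le_trans m'm _.
rewrite mulrA ler_pdivlMr//.
have -> : 30 * k%:R * (eps / 30) * sigma ^+ 2 = eps * (k%:R * sigma ^+ 2) by field.
by rewrite ler_pM2l.
Qed.
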